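(* Let $\mathcal{Y}$ be a random edge-labeled network with edges labeled by $\mathbb{N}=\{1,2,\dots\}$ which is edge exchangeable and which is blip-free with probability $1$. Then there exists a probability measure $\phi$ on $\mathcal{F}_1$ such that $\mathcal{Y}\sim\epsilon_\phi$, where $$\epsilon_\phi(\cdot)=\int_{\mathcal{F}_1}\epsilon_f(\cdot)\,\phi(df).$$ That is, $\mathcal{Y}$ can be generated by first sampling $f\sim\phi$ and then, given $f$, setting $\mathcal{Y}=\mathcal{E}_{\mathcal{X}}$ where $\mathcal{X}:\mathbb{N}\to\mathrm{fin}(\mathbb{N})$, $\mathcal{X}(i)=X_i$, with $X_1,X_2,\dots$ i.i.d. satisfying $\mathrm{pr}(X_i=s\mid f)=f_s$ for $s\in\mathrm{fin}(\mathbb{N})$.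
   Context: For a set $\mathcal{P}$, $\mathrm{fin}(\mathcal{P})$ denotes the set of finite ordered multisets of $\mathcal{P}$, i.e. finite sequences $(s_1,\dots,s_r)$ of elements of $\mathcal{P}$. An interaction process is a map $\mathcal{I}:S\to\mathrm{fin}(\mathcal{P})$ with $S\subseteq\mathbb{N}$. A bijection $\rho:\mathcal{P}\to\mathcal{P}'$ acts by $(\rho\mathcal{I})(i)=(\rho(s_1),\dots,\rho(s_r))$ when $\mathcal{I}(i)=(s_1,\dots,s_r)$. The edge-labeled network $\mathcal{E}_{\mathcal{I}}$ induced by $\mathcal{I}$ is the equivalence class of all $\mathcal{I}':S\to\mathrm{fin}(\mathcal{P}')$ (with $\#\mathcal{P}'=\#\mathcal{P}$) such that $\mathcal{I}'=\rho\mathcal{I}$ for some bijection $\rho:\mathcal{P}\to\mathcal{P}'$; i.e. vertex labels are forgotten while edge labels $i\in S$ are kept. $\mathfrak{E}_S$ is the set of such networks with edges labeled in $S$. The restriction $\mathcal{E}|_{S'}$ for $S'\subseteq S$ removes edges with labels outside $S'$; $\mathfrak{E}_{\mathbb{N}}$ carries the Borel $\sigma$-field of the metric $d(\mathcal{E},\mathcal{E}')=1/(1+\sup\{n:\mathcal{E}|_{[n]}=\mathcal{E}'|_{[n]}\})$. For a permutation $\sigma$ of $S$, $\mathcal{E}^\sigma$ is the network induced by $\mathcal{I}^\sigma(i)=\mathcal{I}(\sigma^{-1}(i))$ (edges relabeled). A random $\mathcal{Y}\in\mathfrak{E}_S$ is edge exchangeable if $\mathcal{Y}^\sigma$ and $\mathcal{Y}$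 have the same distribution for all permutations $\sigma:S\to S$. An interaction (a value $s$ of the interaction process, up to vertex relabeling) is a blip if it occurs for exactly one edge label; a network is blip-free if it contains no blips. $\mathcal{F}_1=\{(f_s)_{s\in\mathrm{fin}(\mathbb{N})}: f_s\ge0,\ \sum_s f_s=1\}$, and for $f\in\mathcal{F}_1$, $\epsilon_f$ denotes the distribution of $\mathcal{E}_{\mathcal{X}}$ where $\mathcal{X}(i)=X_i$ with $X_1,X_2,\dots$ i.i.d. with $\mathrm{pr}(X_i=s)=f_s$. *)

(* Defs.v *)
From HB Require Import structures.
From mathcomp Require Import all_boot all_order all_algebra.
From mathcomp Require Import all_classical all_reals all_analysis.
Set Implicit Arguments. Unset Strict Implicit. Unset Printing Implicit Defensive.
Import Order.TTheory GRing.Theory Num.Theory.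
Local Open Scope classical_set_scope.
Local Open Scope ring_scope.

(* An interaction process I : N -> fin(P) is represented with vertex set     *)
(* P = nat, and fin(P) = seq nat (finite ordered multisets = sequences).     *)
(* Edge label i+1 of the paper is represented by i : nat (labels start at 0).*)
(* A network (equivalence class up to vertex relabelling) is represented by  *)
(* any of its representatives; the sigma-field below only contains sets that *)
(* are invariant under vertex relabelling, so events about the network are   *)
(* exactly the measurable sets of representatives.                           *)
Definition iproc := nat -> seq nat.

(* relabel edges : (I^sigma)(i) = I(sigma^-1 i), here sigma^-1 = sinv *)
Definition edge_relabel (sinv : nat -> nat) (I : iproc) : iproc :=
  fun i => I (sinv i).

(* E_I |_[n] = E_J |_[n] : there is a vertex bijection rho with
   J(i) = rho I(i) for every edge label i in [n] (i.e. i < n here). *)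
Definition restr_eq (n : nat) (I J : iproc) : Prop :=
  exists rho : nat -> nat, bijective rho /\
    forall i, (i < n)%N -> J i = map rho (I i).

(* The set {E' : E'|_[n] = E_I|_[n]}; these are exactly the open balls of the
   metric d(E,E') = 1/(1 + sup{n : E|_[n] = E'|_[n]}). *)
Definition cylinder (n : nat) (I : iproc) : set iproc := [set J | restr_eq n I J].

Definition cylinders : set (set iproc) :=
  [set A | exists n I, A = cylinder n I].

HB.instance Definition _ := isPointed.Build (seq nat) [::].
Definition network : pointedType := iproc.

(* The measurable space \frak{E}_N: Borel sigma-field of the metric d,
   i.e. the sigma-field generated by its balls (the cylinders). *)
Definition Network := g_sigma_algebraType (cylinders : set (set network)).

Definition blip_free (I : iproc) : Prop :=
  forall i, exists j, j <> i /\ I j = I i.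

Section F1.
Variable R : realType.

Definition isF1 (f : seq nat -> R) : Prop :=
  (forall s, 0 <= f s) /\ (\esum_(s in [set: seq nat]) (f s)%:E = 1)%E.

Record F1 := MkF1 { F1val :> seq nat -> R ; F1P : isF1 F1val }.

Definition f1_point_fun (s : seq nat) : R := if s == [::] then 1 else 0.

Lemma f1_point_P : isF1 f1_point_fun.
Proof.
split=> [s|]; first by rewrite /f1_point_fun; case: eqP.
transitivity (\esum_(s in [set: seq nat])
   (if s \in [set [::] : seq nat] then (1%:E : \bar R) else 0%E)).
  apply: eq_esum => s _; rewrite /f1_point_fun.
  case: eqP => [->|ne]; first by rewrite mem_set.
  by rewrite memNset.
by rewrite -esum_mkcond esum_set1.
Qed.

HB.instance Definition _ := gen_eqMixin F1.
HB.instance Definition _ := gen_choiceMixin F1.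
HB.instance Definition _ := isPointed.Build F1 (MkF1 f1_point_P).

Definition F1_generators : set (set F1) :=
  [set A | exists (s : seq nat) (B : set R), measurable B /\
                 A = [set f : F1 | B (F1val f s)]].

Definition F1space := g_sigma_algebraType F1_generators.
End F1.

(* X : nat -> Omega -> fin(N) (fin(N) with its discrete sigma-field).        *)
Definition iid_with_law (R : realType) (d : measure_display)
  (Omega : measurableType d) (P : probability Omega R)
  (f : seq nat -> R) (X : nat -> Omega -> seq nat) : Prop :=
  [/\ (forall i (B : set (seq nat)), measurable (X i @^-1` B)),
      (forall i s, P (X i @^-1` [set s]) = (f s)%:E) &
      (forall (J : seq nat) (B : nat -> set (seq nat)), uniq J ->
         P (\bigcap_(j in [set j | j \in J]) (X j @^-1` B j))
         = \big[*%E/1%E]_(j <- J) P (X j @^-1` B j))].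

Definition is_epsilon (R : realType) (f : seq nat -> R)
    (mu : set Network -> \bar R) : Prop :=
  exists (d : measure_display) (Omega : measurableType d)
         (P : probability Omega R) (X : nat -> Omega -> seq nat),
    iid_with_law P f X /\
    forall A : set Network, measurable A ->
      mu A = P ((fun w => (fun i => X i w) : Network) @^-1` A).

(* Main.v *)
Require Import Defs.
From HB Require Import structures.
From mathcomp Require Import all_boot all_order all_algebra.
From mathcomp Require Import all_classical all_reals all_analysis.
From mathcomp Require Import measurable_realfun zify ring lra.
Import Order.TTheory GRing.Theory Num.Theory.
Import numFieldNormedType.Exports.
Local Open Scope classical_set_scope.

(** Name the vertices of a network by their order of first appearance; these
    names depend on the network only, so the edges become labelled words.  Let
    [l s] be the limit along [N = 4^k] of the proportion of the first [N] edges
    that carry the word [s].  A second moment computation for the exchangeable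
    indicators "edge [j] equals edge [m]" shows that almost surely all these
    limits exist.  The mean of the sum of [l] over the words of the first [m]
    edges is at least the probability that edge [m] repeats an earlier one;
    exchanging edges, this is the probability that edge [0] recurs among the
    edges [1..m], which tends to [1] since there are no blips.  Hence [l] is
    almost surely a probability on words.

    Let [A] be an event on the first [n] edges.  By exchangeability its
    probability is, up to [O(1/N)], the mean of the proportion of maps
    [tau : [n] -> [N]] for which the network with edges [tau 0, ..., tau (n-1)]
    lies in [A], and the limit inferior of that proportion is at least the
    probability [epsilon_l A] of [A] under i.i.d. sampling from [l].  Fatou's
    lemma gives [E (epsilon_l A) <= P A]; the complement of [A] satisfies the
    same inequality, so equality holds.  The naming of the vertices is not
    exchangeable, but only the relabelling-invariance of [A] is used. *)

Set Implicit Arguments.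
Unset Strict Implicit.
Unset Printing Implicit Defensive.

(** * Networks and their canonical representatives *)

(** Induction on [n]: follow the permutation found so far by the transposition of its value at [n]
    with [tau n]. Earlier values differ from both by injectivity, so they stay in place. Edge
    exchangeability, stated for permutations, thereby reaches finite injections. *)
Lemma extend_injection n (tau : nat -> nat) :
  {in gtn n &, injective tau} ->
  exists s sinv, [/\ cancel s sinv, cancel sinv s &
    forall i, (i < n)%N -> s i = tau i].
Proof.
elim: n => [|n IH] tauI; first by exists id, id.
have [|s [t [sK tK stau]]] := IH.
  by move=> i j /= ip jp; apply: tauI; rewrite inE ltnW.
pose swap (a b x : nat) := if x == a then b else if x == b then a else x.
have swapK a b : involutive (swap a b).
  move=> x; rewrite /swap; have [->|xa] := eqVneq x a.
    by rewrite eqxx; case: eqVneq.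
  have [->|xb] := eqVneq x b; first by rewrite eqxx.
  by rewrite (negbTE xa) (negbTE xb).
exists (swap (s n) (tau n) \o s), (t \o swap (s n) (tau n)); split.
- by move=> i /=; rewrite swapK sK.
- by move=> i /=; rewrite tK swapK.
move=> i; rewrite ltnS leq_eqVlt => /orP[/eqP->|lt_in] /=.
  by rewrite /swap eqxx.
rewrite /swap (can_eq sK) (ltn_eqF lt_in) stau//.
case: eqP => // /tauI; rewrite !inE => /(_ (ltnW lt_in) (ltnSn n)) eq_in.
by rewrite eq_in ltnn in lt_in.
Qed.

(** List [vs] without repetition as [us]. One permutation extends [i |-> us_i], another extends
    [i |-> g us_i]; [rho] is the second after the inverse of the first. *)
Lemma extend_partial_injection (vs : seq nat) (g : nat -> nat) :
  {in vs &, injective g} -> exists rho, bijective rho /\ {in vs, rho =1 g}.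
Proof.
move=> gI; set us := undup vs; set n := size us.
have usI : {in gtn n &, injective (nth 0 us)}.
  by move=> i j /= ilt jlt /eqP; rewrite nth_uniq ?undup_uniq// => /eqP.
have [s [t [sK tK sE]]] := extend_injection usI.
have [|s' [t' [sK' tK' sE']]] := @extend_injection n (g \o nth 0 us).
  move=> i j /= ilt jlt /gI; rewrite -!(mem_undup vs) !mem_nth// => /(_ isT isT).
  exact: usI.
exists (s' \o t); split; first by exists (s \o t') => i /=; rewrite ?sK' ?sK ?tK ?tK'.
move=> v; rewrite -mem_undup => vus /=.
have vlt : (index v us < n)%N by rewrite index_mem.
have -> : t v = index v us by rewrite -[v in LHS](nth_index 0 vus) -sE// sK.
by rewrite sE'//= nth_index.
Qed.

Lemma restr_eq_sym n I J : restr_eq n I J -> restr_eq n J I.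
Proof.
move=> [rho [[rho' rK rK'] IJ]]; exists rho'; split; first by exists rho.
by move=> i lt_in; rewrite IJ// mapK.
Qed.

Lemma restr_eq_trans n I J K : restr_eq n I J -> restr_eq n J K -> restr_eq n I K.
Proof.
move=> [r [bij_r IJ]] [r' [bij_r' JK]]; exists (r' \o r); split; first exact: bij_comp.
by move=> i lt_in; rewrite JK// IJ// map_comp.
Qed.

Lemma restr_eqS m n I J : (m <= n)%N -> restr_eq n I J -> restr_eq m I J.
Proof.
by move=> le_mn [r [bij_r IJ]]; exists r; split=> // i /leq_trans/(_ le_mn)/IJ.
Qed.

Lemma restr_eq_relabel n N (tau : nat -> nat) I J :
  (forall i, (i < n)%N -> (tau i < N)%N) -> restr_eq N I J ->
  restr_eq n (edge_relabel tau I) (edge_relabel tau J).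
Proof.
by move=> taulN [r [bij_r IJ]]; exists r; split=> // i lt_in; apply/IJ/taulN.
Qed.

Lemma eq_restr_eq n I J : (forall i, (i < n)%N -> I i = J i) -> restr_eq n I J.
Proof.
by move=> IJ; exists id; split=> [|i /IJ ->]; [exists id|rewrite map_id].
Qed.

Lemma restr_eq_edges n I J i j : restr_eq n I J -> (i < n)%N -> (j < n)%N ->
  (J i == J j) = (I i == I j).
Proof.
move=> [r [/bij_inj rI IJ]] lt_in lt_jn; rewrite !IJ//.
by rewrite (inj_eq (inj_map rI)).
Qed.

(* The vertices are named by the position of their first occurrence in the
   concatenation of the edges, so that the names only depend on the network. *)
Definition canonize (I : iproc) : iproc :=
  fun i => map (index ^~ (flatten (map I (iota 0 i.+1)))) (I i).

Lemma mem_edges n (I : iproc) i v : (i < n)%N -> v \in I i ->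
  v \in flatten (map I (iota 0 n)).
Proof.
move=> lt_in vi; apply/flattenP; exists (I i) => //.
by apply: map_f; rewrite mem_iota.
Qed.

(** A first occurrence keeps its position when the list grows, so a single list serves all edges
    below [n]. *)
Lemma canonizeE n I i : (i < n)%N ->
  canonize I i = map (index ^~ (flatten (map I (iota 0 n)))) (I i).
Proof.
move=> lt_in; apply/eq_in_map => v vi.
rewrite -(subnKC lt_in) (iotaD 0 i.+1) map_cat flatten_cat [RHS]index_cat.
by have -> := mem_edges (ltnSn i) vi.
Qed.

(** The position of a listed vertex determines the vertex, so the naming is injective on the
    vertices of the first [n] edges and extends to a bijection, which depends on [n]. *)
Lemma canonize_restr_eq n I : restr_eq n I (canonize I).
Proof.
set vs := flatten (map I (iota 0 n)).
have [|r [bij_r rE]] := @extend_partial_injection vs (index ^~ vs).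
  by move=> u v uvs vvs /= /(congr1 (nth 0 vs)); rewrite !nth_index.
exists r; split=> // i lt_in; rewrite (canonizeE _ lt_in).
by apply/eq_in_map => v vi; rewrite rE// (mem_edges lt_in vi).
Qed.

Lemma canonize_invariant n I J i : restr_eq n I J -> (i < n)%N -> canonize J i = canonize I i.
Proof.
move=> [r [/bij_inj rI IJ]] lt_in; rewrite !(canonizeE _ lt_in) IJ// -map_comp.
apply/eq_in_map => v vi /=.
have -> : map J (iota 0 n) = map (map r) (map I (iota 0 n)).
  by rewrite -map_comp; apply/eq_in_map => j; rewrite mem_iota => /IJ.
by rewrite -map_flatten index_map.
Qed.

Lemma canonize_eq I i j : (canonize I i == canonize I j) = (I i == I j).
Proof.
by apply: (@restr_eq_edges (maxn i j).+1);
  [exact: canonize_restr_eq|rewrite ltnS leq_maxl|rewrite ltnS leq_maxr].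
Qed.

(** * Events on finitely many edges *)

Definition determined n (A : set iproc) :=
  forall I J, restr_eq n I J -> A I -> A J.

Definition pad (w : seq (seq nat)) : iproc := fun i => nth [::] w i.

Definition initseg (n : nat) (I : iproc) : seq (seq nat) := map I (iota 0 n).

Lemma pad_initseg n I i : (i < n)%N -> pad (initseg n I) i = I i.
Proof.
by move=> lt_in; rewrite /pad (nth_map 0) ?size_iota// nth_iota.
Qed.

Lemma determinedC n A : determined n A -> determined n (~` A).
Proof. by move=> dA I J IJ /= nAI AJ; apply/nAI/dA/AJ/restr_eq_sym. Qed.

Lemma determinedI n A B : determined n A -> determined n B -> determined n (A `&` B).
Proof. by move=> dA dB I J IJ [AI BI]; split; [exact: dA AI|exact: dB BI]. Qed.

Lemma determinedT n : determined n setT.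
Proof. by []. Qed.

Lemma determined_cylinder n I : determined n (cylinder n I).
Proof. by move=> J K JK IJ; exact: restr_eq_trans JK. Qed.

Lemma determined_eq i j n : (i < n)%N -> (j < n)%N ->
  determined n [set I | I i = I j].
Proof.
by move=> lt_in lt_jn I J IJ /= /eqP; rewrite -(restr_eq_edges IJ)// => /eqP.
Qed.

Lemma determined_canonize i n (s : seq nat) : (i < n)%N ->
  determined n [set I | canonize I i = s].
Proof. by move=> lt_in I J IJ /= <-; exact: canonize_invariant IJ lt_in. Qed.

Lemma determined_relabel n N (tau : nat -> nat) A :
  (forall i, (i < n)%N -> (tau i < N)%N) -> determined n A ->
  determined N [set I | A (edge_relabel tau I)].
Proof.
by move=> taulN dA I J IJ /=; apply: dA; exact: restr_eq_relabel IJ.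
Qed.

(** Finite words are countable in number, and [A] is the union of the cylinders around those padded
    words that lie in it. *)
Lemma determined_measurable n (A : set Network) : determined n A -> measurable A.
Proof.
move=> dA; have -> : A = \bigcup_(w : seq (seq nat))
    (if pselect (A (pad w)) then cylinder n (pad w) else set0).
  apply/seteqP; split=> [I AI|I [w _]].
    exists (initseg n I) => //; case: pselect => [Aw|]; last case.
      by apply: eq_restr_eq => i; exact: pad_initseg.
    by apply: (dA I) => //; apply: eq_restr_eq => i lt_in; rewrite pad_initseg.
  by case: pselect => // Aw cI; exact: dA cI Aw.
apply: countable_bigcupT_measurable => //= w.
case: pselect => Aw; last exact: measurable0.
by apply: sub_sigma_algebra; exists n, (pad w).
Qed.

(** Cylinders are balls of an ultrametric: two of them are nested or disjoint. With the empty set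
    added they form a pi-system, as needed for Dynkin induction. *)
Lemma cylinder_setI_closed : setI_closed (cylinders `|` [set set0] : set (set iproc)).
Proof.
move=> A B [[n [I ->]]|->]; last by rewrite set0I; right.
move=> [[m [J ->]]|->]; last by rewrite setI0; right.
wlog le_nm : n m I J / (n <= m)%N => [hw|].
  by case/orP: (leq_total n m) => /hw => // h; rewrite setIC; exact: h.
have [[K [IK JK]]|noK] := pselect (exists K, cylinder n I K /\ cylinder m J K).
  left; exists m, J; apply/setIidr => L JL.
  apply: restr_eq_trans IK _; apply: restr_eqS le_nm _.
  exact: restr_eq_trans (restr_eq_sym JK) JL.
right; apply/seteqP; split=> // K [IK JK]; exfalso.
by apply: noK; exists K.
Qed.

Lemma measurable_NetworkE : @measurable _ Network = <<s cylinders `|` [set set0] >>.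
Proof.
apply/seteqP; split.
  apply: smallest_sub; first exact: smallest_sigma_algebra.
  by move=> A cA; apply: sub_sigma_algebra; left.
apply: smallest_sub; first exact: smallest_sigma_algebra.
move=> A [cA|->]; last exact: measurable0.
exact: sub_sigma_algebra.
Qed.

Local Open Scope ring_scope.

(** * Independent sampling from a discrete law *)

(** Transports a family over a countable type to [nat] along [pickle], so that sums over [D] become
    series; [v0] is the neutral value (0 or the empty set) at integers that code no element of
    [D]. *)
Definition opickled (C : countType) (V : Type) (D : set C) (v0 : V) (v : C -> V)
    (n : nat) : V :=
  if @pickle_inv C n is Some c then (if c \in D then v c else v0) else v0.

Lemma opickledE (C : countType) V (D : set C) (v0 : V) v c :
  opickled D v0 v (pickle c) = if c \in D then v c else v0.
Proof. by rewrite /opickled pickleK_inv. Qed.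

Lemma esum_series (R : realType) (C : countType) (D : set C) (a : C -> \bar R) :
  (forall c, 0 <= a c)%E ->
  (\esum_(c in D) a c = \sum_(n <oo) opickled D 0 a n)%E.
Proof.
move=> a0; rewrite nneseries_esumT; last first.
  by move=> n; rewrite /opickled; case: pickle_inv => // c; case: ifP.
have bijD : set_bij D (pickle @` D) pickle.
  by split=> [c Dc|c c' _ _|n [c Dc <-]]; [exists c|exact: (pcan_inj pickleK)|exists c].
transitivity (\esum_(n in pickle @` D) opickled D 0%E a n).
  rewrite (@reindex_esum _ _ _ _ _ _ _ bijD); apply: eq_esum => c Dc.
  by rewrite opickledE mem_set.
rewrite esum_mkcond; apply: eq_esum => n _; case: ifPn => // /negP nD.
rewrite /opickled; case E : pickle_inv => [c|//]; case: ifPn => // cD.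
exfalso; apply: nD; rewrite inE; exists c; first exact: set_mem.
by have := @pickle_invK C n; rewrite E.
Qed.

Lemma esumZ (R : realType) (C : countType) (D : set C) (x : R) (a : C -> \bar R) :
  0 <= x -> (forall c, 0 <= a c)%E ->
  (\esum_(c in D) (x%:E * a c) = x%:E * \esum_(c in D) a c)%E.
Proof.
move=> x0 a0; rewrite !esum_series//; last by move=> c; rewrite mule_ge0.
rewrite -nneseriesZl; last first.
  by move=> n _; rewrite /opickled; case: pickle_inv => // c; case: ifP.
apply: eq_eseriesr => n _; rewrite /opickled.
by case: pickle_inv => [c|]; [case: ifP|]; rewrite ?mule0.
Qed.

Lemma measure_bigcup_countable d (T : measurableType d) (R : realType)
    (mu : {measure set T -> \bar R}) (C : countType) (D : set C) (F : C -> set T) :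
  (forall c, measurable (F c)) -> trivIset D F ->
  mu (\bigcup_(c in D) F c) = \esum_(c in D) mu (F c).
Proof.
move=> mF tF; rewrite esum_series//.
pose G := opickled D set0 F.
have mG n : measurable (G n).
  by rewrite /G /opickled; case: pickle_inv => // c; case: ifP.
have -> : \bigcup_(c in D) F c = \bigcup_n G n.
  apply/seteqP; split=> [x [c Dc Fx]|x [n _]].
    by exists (pickle c) => //; rewrite /G opickledE mem_set.
  rewrite /G /opickled; case: pickle_inv => // c; case: ifPn => // cD Fx.
  by exists c => //; exact: set_mem.
rewrite measure_semi_bigcup//; last 2 first.
- apply/trivIsetP => n m _ _; apply: contra_neqP => /eqP/set0P[x [Gn Gm]].
  move: Gn Gm; rewrite /G /opickled.
  have := @pickle_invK C n; have := @pickle_invK C m.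
  case: (@pickle_inv C n) => //= c; case: (@pickle_inv C m) => //= c' <- <-.
  case: ifPn => // /set_mem Dc Fx; case: ifPn => // /set_mem Dc' Fx'.
  by congr pickle; apply: tF => //; exists x.
- exact: bigcupT_measurable.
apply: eq_eseriesr => n _; rewrite /G /opickled.
by case: pickle_inv => // c; case: ifP.
Qed.

(** * An i.i.d. sequence of words built on the unit interval *)

Section iid.
Variables (R : realType) (f : F1 R).

Let f_ge0 s : 0 <= f s. Proof. exact: (F1P f).1. Qed.

Let fsum : (\esum_(s in [set: seq nat]) (f s)%:E = 1)%E.
Proof. exact: (F1P f).2. Qed.

Definition pmass (n : nat) : R := opickled setT 0 f n.

Definition cumul (n : nat) : R := \sum_(k < n) pmass k.

Lemma pmass_ge0 n : 0 <= pmass n.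
Proof. by rewrite /pmass /opickled; case: pickle_inv => // s; case: ifP. Qed.

Lemma pmass_pickle s : pmass (pickle s) = f s.
Proof. by rewrite /pmass opickledE in_setT. Qed.

Lemma cumul_series : (\sum_(n <oo) (pmass n)%:E = 1)%E.
Proof.
rewrite -fsum esum_series//; apply: eq_eseriesr => n _.
by rewrite /pmass /opickled; case: pickle_inv => // s; case: ifP.
Qed.

Lemma cumulS n : cumul n.+1 = cumul n + pmass n.
Proof. by rewrite /cumul big_ord_recr. Qed.

Lemma cumul_le m n : (m <= n)%N -> cumul m <= cumul n.
Proof.
elim: n => [|n IH]; first by rewrite leqn0 => /eqP->.
rewrite leq_eqVlt => /orP[/eqP->//|]; rewrite ltnS => /IH le_mn.
by rewrite cumulS (le_trans le_mn)// lerDl pmass_ge0.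
Qed.

Lemma cumul_ge0 n : 0 <= cumul n.
Proof. by rewrite sumr_ge0// => k _; exact: pmass_ge0. Qed.

Lemma cumulE n : (cumul n)%:E = (\sum_(0 <= k < n) (pmass k)%:E)%E.
Proof. by rewrite /cumul -sumEFin big_mkord. Qed.

Lemma cumul_le1 n : cumul n <= 1.
Proof.
rewrite -lee_fin cumulE -cumul_series; apply: nneseries_lim_ge => k _ _.
by rewrite lee_fin pmass_ge0.
Qed.

Lemma cumul_exceeds (x : R) : x < 1 -> exists n, x < cumul n.+1.
Proof.
move=> x1; apply: contrapT => /forallNP nx.
have : (1 <= x%:E)%E.
  rewrite -cumul_series; apply: lime_le.
    by apply: is_cvg_nneseries => n _ _; rewrite lee_fin pmass_ge0.
  apply: nearW => n; rewrite -cumulE lee_fin.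
  apply: (le_trans (cumul_le (leqnSn n))).
  by rewrite leNgt; apply/negP/nx.
by rewrite lee_fin leNgt x1.
Qed.

(* The interval [0, 1[ is split into consecutive intervals of lengths f s; a
   point is sent to the index of its interval, then the interval is stretched
   onto [0, 1[ and the procedure is repeated, as for the digits of a number. *)
Definition digit (x : R) : nat :=
  if pselect (exists n, x < cumul n.+1) is left ex then ex_minn ex else 0%N.

Definition stretch (x : R) : R := (x - cumul (digit x)) / pmass (digit x).

Definition letter (x : R) : seq nat := odflt [::] (pickle_inv (digit x)).

Lemma digitP (x : R) : 0 <= x < 1 -> cumul (digit x) <= x < cumul (digit x).+1.
Proof.
move=> /andP[x0 x1]; rewrite /digit; case: pselect => [ex|]; last first.
  by case; exact: cumul_exceeds.
case: ex_minnP => n xn minn; rewrite xn andbT.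
case: n minn {xn} => [|n] minn; first by rewrite /cumul big_ord0.
by rewrite leNgt; apply/negP => /minn; rewrite ltnn.
Qed.

Lemma digit_uniq (x : R) n : 0 <= x < 1 -> cumul n <= x < cumul n.+1 -> digit x = n.
Proof.
move=> /digitP /andP[d1 d2] /andP[n1 n2].
have [lt|lt|//] := ltngtP (digit x) n.
  by exfalso; move: (cumul_le lt) => {lt}; lra.
by exfalso; move: (cumul_le lt) => {lt}; lra.
Qed.

Lemma letterP (x : R) s : 0 <= x < 1 ->
  letter x = s <-> cumul (pickle s) <= x < cumul (pickle s) + f s.
Proof.
move=> x01; rewrite -pmass_pickle -cumulS; split=> [<-|/(digit_uniq x01)]; last first.
  by rewrite /letter => ->; rewrite pickleK_inv.
suff -> : pickle (letter x) = digit x by exact: digitP.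
have /andP[d1 d2] := digitP x01; move: d1 d2; rewrite /letter cumulS /pmass /opickled.
have := @pickle_invK (seq nat) (digit x).
(* An integer coding no word has mass 0, hence an empty interval, so [letter] does not take its
   default value here. *)
by case: pickle_inv => [s'//|] _ d1 d2; exfalso; lra.
Qed.

Lemma stretch_itv (x : R) : 0 <= x < 1 -> 0 <= stretch x < 1.
Proof.
move=> x01; have /andP[d1 d2] := digitP x01; move: d2; rewrite cumulS => d2.
have p0 : 0 < pmass (digit x) by lra.
rewrite /stretch divr_ge0 ?subr_ge0// ?ltW// ltr_pdivrMr// mul1r; lra.
Qed.

Definition wmass (w : seq (seq nat)) : R := \prod_(s <- w) f s.

Lemma wmass_ge0 w : 0 <= wmass w.
Proof. by rewrite prodr_ge0. Qed.

(** The points with first letter [s] form an interval of length [f s], which [stretch] maps affinely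
    onto the unit interval. Pulling back the interval of [w], with left end [a], gives left end
    [cumul (pickle s) + f s * a] and length [f s * wmass w]. *)
Lemma word_itv w : exists a : R, [/\ 0 <= a, a + wmass w <= 1 &
  forall x : R, 0 <= x < 1 ->
    (forall i, (i < size w)%N -> letter (iter i stretch x) = nth [::] w i) <->
    a <= x < a + wmass w].
Proof.
elim: w => [|s w [a [a0 a1 aP]]].
  by exists 0; rewrite /wmass big_nil add0r; split.
have ws : wmass (s :: w) = f s * wmass w by rewrite /wmass big_cons.
have w0 := wmass_ge0 w; have s0 := f_ge0 s.
have c0 := cumul_ge0 (pickle s).
have c1 : cumul (pickle s) + f s <= 1 by rewrite -pmass_pickle -cumulS cumul_le1.
exists (cumul (pickle s) + f s * a); rewrite ws; split; first by nra.
  by nra.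
move=> x x01; split=> [xw|xitv].
  have xs : letter x = s by exact: (xw 0%N).
  have /(letterP _ x01) sitv := xs.
  have dx : digit x = pickle s.
    by apply: digit_uniq => //; rewrite cumulS pmass_pickle.
  have f0 : 0 < f s by lra.
  have /(aP _ (stretch_itv x01)) : forall i, (i < size w)%N ->
      letter (iter i stretch (stretch x)) = nth [::] w i.
    by move=> i lt_iw; rewrite -iterSr; exact: (xw i.+1).
  rewrite /stretch dx pmass_pickle ler_pdivlMr// ltr_pdivrMr//.
  by move=> /andP[h1 h2]; lra.
have sitv : cumul (pickle s) <= x < cumul (pickle s) + f s by nra.
have xs : letter x = s by exact/(letterP _ x01).
have dx : digit x = pickle s.
  by apply: digit_uniq => //; rewrite cumulS pmass_pickle.
have f0 : 0 < f s by lra.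
have /(aP _ (stretch_itv x01)) h : a <= stretch x < a + wmass w.
  rewrite /stretch dx pmass_pickle ler_pdivlMr// ltr_pdivrMr//.
  by move: xitv => /andP[h1 h2]; lra.
by case=> [//|i]; rewrite ltnS iterSr /=; exact: h.
Qed.

(** The sample space is the whole line, whose type is already a measurable space; points outside
    [[0, 1[] form a null set, and [letters] sends them to the constant sequence [[::]]. *)
Definition unit_itv_prob : set (measurableTypeR R) -> \bar R :=
  mrestr (@lebesgue_measure R) (measurable_itv `[0, 1[).

HB.instance Definition _ := Measure.on unit_itv_prob.

Let unit_itv_probT : unit_itv_prob setT = 1%E.
Proof.
by rewrite /unit_itv_prob /mrestr setTI lebesgue_measure_itv/= lte01 sube0.
Qed.

HB.instance Definition _ := Measure_isProbability.Build _ _ _ unit_itv_prob unit_itv_probT.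

Definition letters (x : measurableTypeR R) : Network :=
  fun i => if 0 <= x < 1 then letter (iter i stretch x) else [::].

Definition word_event (w : seq (seq nat)) : set (measurableTypeR R) :=
  [set x | initseg (size w) (letters x) = w].

Lemma word_eventP w (x : R) : 0 <= x < 1 ->
  word_event w x <->
  (forall i, (i < size w)%N -> letter (iter i stretch x) = nth [::] w i).
Proof.
move=> x01; rewrite /word_event/=; split=> [xw i lt_iw|xw].
  by rewrite -xw -/(pad _ _) pad_initseg// /letters x01.
apply: (@eq_from_nth _ [::]); first by rewrite size_map size_iota.
move=> i; rewrite size_map size_iota => lt_iw.
by rewrite -/(pad _ _) pad_initseg// /letters x01 xw.
Qed.

Lemma word_event_in w : exists a : R, [/\ 0 <= a, a + wmass w <= 1 &
  word_event w `&` `[0, 1[%classic = `[a, a + wmass w[%classic].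
Proof.
have [a [a0 a1 aP]] := word_itv w; exists a; split=> //.
apply/seteqP; split=> x /=; rewrite !in_itv/=.
  by move=> [xw x01]; apply/(aP _ x01)/word_eventP.
move=> xa; have x01 : 0 <= x < 1 by have := wmass_ge0 w; lra.
by split=> //; apply/word_eventP => //; exact/aP.
Qed.

Lemma measurable_word_event w : measurable (word_event w).
Proof.
have [a [_ _ wa]] := word_event_in w.
(* Outside [[0, 1[] all letters are [[::]], so those points belong to the event exactly when [w]
   repeats [[::]]. *)
have -> : word_event w = `[a, a + wmass w[%classic `|`
    (if w == nseq (size w) [::] then ~` `[0, 1[%classic else set0).
  rewrite -wa; apply/seteqP; split=> x.
    have [x01|x01] := boolP (0 <= x < 1); first by left; split; rewrite //= in_itv.
    move=> /= xw; right.
    have -> : w == nseq (size w) [::].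
      rewrite -[X in X == _]xw; apply/eqP/(@eq_from_nth _ [::]).
        by rewrite size_map size_iota size_nseq.
      move=> i; rewrite size_map size_iota => lt_iw.
      by rewrite nth_nseq lt_iw -/(pad _ _) pad_initseg// /letters (negbTE x01).
    by rewrite /= in_itv/=; exact/negP.
  move=> [[]//|]; case: ifPn => // /eqP wE; rewrite /= in_itv/= => /negP x01.
  rewrite /word_event/= [RHS]wE; apply: (@eq_from_nth _ [::]).
    by rewrite size_map size_iota size_nseq.
  move=> i; rewrite size_map size_iota => lt_iw.
  by rewrite nth_nseq lt_iw -/(pad _ _) pad_initseg// /letters (negbTE x01).
apply: measurableU; first exact: measurable_itv.
case: ifP => _; last exact: measurable0.
by apply: measurableC; exact: measurable_itv.
Qed.

Lemma word_event_prob w : unit_itv_prob (word_event w) = (wmass w)%:E.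
Proof.
have [a [_ _ wa]] := word_event_in w.
rewrite /unit_itv_prob /mrestr wa lebesgue_measure_itv/= lte_fin ltrDl.
case: ifPn => [_|]; first by rewrite -EFinB addrC addKr.
by rewrite -leNgt => w0; congr EFin; apply/eqP; rewrite eq_le wmass_ge0 w0.
Qed.

Lemma initseg_event n (D : set (seq (seq nat))) :
  [set x | D (initseg n (letters x))] =
  \bigcup_(w in [set w | size w = n /\ D w]) word_event w.
Proof.
apply/seteqP; split=> [x /= Dx|x [w [<- Dw] /= xw]]; last by rewrite /= xw.
exists (initseg n (letters x)); first by rewrite /= size_map size_iota.
by rewrite /word_event/= size_map size_iota.
Qed.

Lemma measurable_initseg_event n (D : set (seq (seq nat))) :
  measurable [set x | D (initseg n (letters x))].
Proof.
rewrite initseg_event bigcup_mkcond; apply: countable_bigcupT_measurable => // w.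
by case: ifP => _; [exact: measurable_word_event|exact: measurable0].
Qed.

Lemma trivIset_word_event n : trivIset [set w | size w = n] word_event.
Proof.
by move=> w w' /= sw sw' [x []]; rewrite /word_event/= sw sw' => -> ->.
Qed.

Lemma initseg_law n (D : set (seq (seq nat))) :
  unit_itv_prob [set x | D (initseg n (letters x))] =
  \esum_(w in [set w | size w = n /\ D w]) (wmass w)%:E.
Proof.
rewrite initseg_event measure_bigcup_countable.
- by apply: eq_esum => w _; exact: word_event_prob.
- exact: measurable_word_event.
- by apply: sub_trivIset (@trivIset_word_event n) => w [].
Qed.

Lemma letters_determined n (A : set Network) : determined n A ->
  letters @^-1` A = [set x | A (pad (initseg n (letters x)))].
Proof.
move=> dA; apply/seteqP; split=> x /=; apply: dA; apply: eq_restr_eq => i lt_in.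
  by rewrite pad_initseg.
by rewrite pad_initseg.
Qed.

Lemma measurable_letters : measurable_fun setT letters.
Proof.
apply: (@measurability _ _ (measurableTypeR R) Network setT _ cylinders) => //.
move=> _ [_ [n [I ->]] <-]; rewrite setTI.
rewrite (letters_determined (@determined_cylinder n I)).
exact: (measurable_initseg_event n [set w | cylinder n I (pad w)]).
Qed.

Definition smass (B : set (seq nat)) : R := fine (\esum_(s in B) (f s)%:E).

Lemma smassE B : \esum_(s in B) (f s)%:E = (smass B)%:E.
Proof.
rewrite fineK//; have le1 : (\esum_(s in B) (f s)%:E <= 1)%E.
  rewrite -fsum esum_mkcond; apply: le_esum => s _.
  by case: ifP => _; rewrite lee_fin.
rewrite ge0_fin_numE ?(le_lt_trans le1) ?ltry//.
by apply: esum_ge0 => s _; rewrite lee_fin.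
Qed.

Lemma smass_ge0 B : 0 <= smass B.
Proof. by rewrite -lee_fin -smassE; apply: esum_ge0 => s _; rewrite lee_fin. Qed.

Lemma smassT : smass setT = 1.
Proof. by rewrite /smass fsum. Qed.

Lemma initsegS n I : initseg n.+1 I = rcons (initseg n I) (I n).
Proof. by rewrite /initseg -addn1 iotaD map_cat cats1. Qed.

Lemma wmass_rcons w s : wmass (rcons w s) = wmass w * f s.
Proof. by rewrite /wmass -cats1 big_cat big_seq1. Qed.

(** Induction on [k], splitting along the letter at position [size w], which is then appended to the
    prefix. The arbitrary prefix [w] is what makes the induction go through. *)
Lemma iid_law_after k w (B : nat -> set (seq nat)) :
  unit_itv_prob (word_event w `&`
    [set x | forall i, (i < k)%N -> B i (letters x (size w + i)%N)]) =
  (wmass w * \prod_(i < k) smass (B i))%:E.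
Proof.
elim: k w B => [|k IH] w B.
  rewrite big_ord0 mulr1 -word_event_prob; congr unit_itv_prob.
  by apply/seteqP; split=> [x []|].
set E := (X in unit_itv_prob X).
pose F s := word_event (rcons w s) `&`
  [set x | forall i, (i < k)%N -> B i.+1 (letters x (size (rcons w s) + i)%N)].
have -> : E = \bigcup_(s in B 0%N) F s.
  apply/seteqP; split=> [x [xw xB]|x [s Bs [xw xB]]].
    exists (letters x (size w)); first by have := xB 0%N isT; rewrite addn0.
    split; first by rewrite /word_event/= size_rcons initsegS xw.
    by move=> i lt_ik; rewrite size_rcons addSnnS; exact: xB.
  move: xw; rewrite /word_event/= size_rcons initsegS => /eqP.
  rewrite eqseq_rcons => /andP[/eqP xw /eqP xs]; split=> //.
  case=> [_|i]; first by rewrite addn0 xs.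
  by rewrite ltnS => /xB; rewrite size_rcons addSnnS.
rewrite measure_bigcup_countable; last 2 first.
- move=> s; apply: measurableI; first exact: measurable_word_event.
  set n := (size (rcons w s) + k)%N.
  rewrite [X in measurable X](_ : _ = [set x | [set w' : seq (seq nat) |
      forall i, (i < k)%N -> B i.+1 (pad w' (size (rcons w s) + i)%N)]
        (initseg n (letters x))]); first exact: measurable_initseg_event.
  by apply/seteqP; split=> x xB i lt_ik; have := xB i lt_ik; rewrite pad_initseg// ltn_add2l.
- move=> s s' _ _ [x [[+ _] [+ _]]].
  rewrite /word_event/= !size_rcons => -> /eqP.
  by rewrite eqseq_rcons => /andP[_ /eqP].
rewrite (eq_esum (b := fun s =>
    ((wmass w * \prod_(i < k) smass (B i.+1))%:E * (f s)%:E)%E)); last first.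
  move=> s _; transitivity (wmass (rcons w s) * \prod_(i < k) smass (B i.+1))%:E.
    exact: (IH (rcons w s) (fun i => B i.+1)).
  by rewrite wmass_rcons -EFinM mulrAC.
rewrite esumZ ?smassE//.
  by rewrite big_ord_recl/= -EFinM; congr EFin; rewrite mulrAC mulrA.
by rewrite mulr_ge0 ?wmass_ge0// prodr_ge0// => i _; exact: smass_ge0.
Qed.

Lemma iid_law k (B : nat -> set (seq nat)) :
  unit_itv_prob [set x | forall i, (i < k)%N -> B i (letters x i)] =
  (\prod_(i < k) smass (B i))%:E.
Proof.
have := iid_law_after k [::] B; rewrite /wmass big_nil mul1r => <-.
congr unit_itv_prob; apply/seteqP; split=> [x xB|x [_ xB]] //.
Qed.

Lemma iid_law_seq (J : seq nat) (B : nat -> set (seq nat)) : uniq J ->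
  unit_itv_prob (\bigcap_(j in [set j | j \in J]) ((letters^~ j) @^-1` B j)) =
  (\prod_(j <- J) smass (B j))%:E.
Proof.
move=> uJ; pose k := (\max_(j <- J) j).+1.
have ltk j : j \in J -> (j < k)%N.
  by move=> jJ; rewrite ltnS; exact: (@leq_bigmax_seq _ J xpredT id j).
(* Positions outside [J] receive the full set, of mass 1, which reduces [J] to an initial
   segment. *)
pose B' j := if j \in J then B j else setT.
have -> : \bigcap_(j in [set j | j \in J]) ((letters^~ j) @^-1` B j) =
    [set x | forall i, (i < k)%N -> B' i (letters x i)].
  apply/seteqP; split=> [x xB i _|x xB j /= jJ]; last first.
    by have := xB j (ltk _ jJ); rewrite /B' jJ.
  by rewrite /B'; case: ifPn => // iJ; exact: (xB i).
rewrite iid_law; congr EFin; rewrite -(big_mkord xpredT (fun i => smass (B' i))).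
rewrite (bigID (mem J))/= [X in _ * X]big1 ?mulr1; last first.
  by move=> i iJ; rewrite /B' (negbTE iJ) smassT.
rewrite -big_filter; transitivity (\prod_(j <- J) smass (B' j)).
  apply: perm_big; apply: uniq_perm => //; first by rewrite filter_uniq// iota_uniq.
  move=> j; rewrite mem_filter mem_index_iota /= andb_idr//.
  exact: ltk.
by rewrite big_seq [RHS]big_seq; apply: eq_bigr => j jJ; rewrite /B' jJ.
Qed.

Lemma letters_iid : iid_with_law unit_itv_prob f (fun i x => letters x i).
Proof.
have law i B : unit_itv_prob ((fun x => letters x i) @^-1` B) = (smass B)%:E.
  have := @iid_law_seq [:: i] (fun=> B) isT; rewrite big_seq1 => <-.
  congr unit_itv_prob; apply/seteqP; split=> [x xB j|x xB].
    by rewrite /= inE => /eqP ->.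
  by apply: (xB i); rewrite /= inE.
split=> [i B|i s|J B uJ].
- have := measurable_initseg_event i.+1 [set w | B (pad w i)].
  congr measurable; apply/seteqP; split=> x /=; by rewrite pad_initseg.
- by apply: eq_trans (law i _) _; rewrite -smassE esum_set1// lee_fin.
apply: eq_trans (iid_law_seq _ uJ) _; rewrite (big_morph _ (@EFinM R) (erefl _)).
by apply: eq_bigr => j _; apply/esym/law.
Qed.

HB.instance Definition _ := isMeasurableFun.Build _ _ _ _ letters measurable_letters.

Definition epsilon : probability Network R := distribution unit_itv_prob letters.

Lemma epsilon_is_epsilon : is_epsilon f epsilon.
Proof.
exists _, (measurableTypeR R), unit_itv_prob, (fun i x => letters x i).
by split=> //; exact: letters_iid.
Qed.

Lemma epsilon_determined n (A : set Network) : determined n A ->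
  epsilon A = \esum_(w in [set w | size w = n /\ A (pad w)]) (wmass w)%:E.
Proof.
move=> dA; rewrite /epsilon /= /distribution /pushforward (letters_determined dA).
exact: (initseg_law n [set w | A (pad w)]).
Qed.

End iid.

(** * Averages of exchangeable indicators *)

Lemma cvgn_of_summable_increments (R : realType) (u : R^nat) :
  (\sum_(k <oo) `|u k.+1 - u k|%:E < +oo)%E -> cvgn u.
Proof.
move=> hu; have cs : cvgn (series (telescope u)).
  apply: normed_cvg; apply: nondecreasing_is_cvgn.
    by apply: nondecreasing_series => n _ _ /=.
  exists (fine (\sum_(k <oo) `|u k.+1 - u k|%:E)) => _ [n _ <-].
  rewrite -lee_fin fineK; last first.
    by rewrite ge0_fin_numE// nneseries_ge0// => k _ _; rewrite lee_fin.
  rewrite /= /series/= -sumEFin; apply: nneseries_lim_ge => k _ _.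
  by rewrite lee_fin.
have -> : u = (fun n => u 0%N + series (telescope u) n).
  by apply/funext => n; exact: eq_sum_telescope.
by apply: is_cvgD => //; exact: is_cvg_cst.
Qed.

(** The sum of the series has finite integral by monotone convergence, hence is finite almost
    everywhere. *)
Lemma ae_summable d (T : measurableType d) (R : realType)
    (mu : {measure set T -> \bar R}) (g : nat -> T -> R) (c : nat -> R) :
  (forall k, measurable_fun setT (g k)) -> (forall k x, 0 <= g k x) ->
  (forall k, \int[mu]_x (g k x)%:E <= (c k)%:E)%E ->
  (\sum_(k <oo) (c k)%:E < +oo)%E ->
  {ae mu, forall x, (\sum_(k <oo) (g k x)%:E < +oo)%E}.
Proof.
move=> mg g0 gc coo.
pose S : T -> \bar R := fun x => (\sum_(k <oo) (g k x)%:E)%E.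
have mS : measurable_fun setT S.
  by apply: ge0_emeasurable_sum => k // *; [rewrite lee_fin|exact/measurable_EFinP].
have S0 x : (0 <= S x)%E.
  by apply: nneseries_ge0 => k _ _; rewrite lee_fin.
have iS : mu.-integrable setT S.
  apply/integrableP; split=> //; apply: le_lt_trans coo.
  under eq_integral do rewrite gee0_abs//.
  rewrite integral_nneseries//; last 2 first.
  - by move=> k; exact/measurable_EFinP.
  - by move=> k x _; rewrite lee_fin.
  apply: lee_nneseries => k _; last exact: gc.
  by move=> _; apply: integral_ge0 => x _; rewrite lee_fin.
have := integrable_ae measurableT iS; apply: filterS => x /(_ Logic.I).
by rewrite ge0_fin_numE.
Qed.

Section indicator_combinations.
Context d (T : measurableType d) (R : realType) (P : probability T R).

Lemma integral_indic_comb (J : Type) (r : seq J) (c : J -> R) (A : J -> set T) :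
  (forall j, measurable (A j)) ->
  (\int[P]_x (\sum_(j <- r) c j * \1_(A j) x)%:E =
   (\sum_(j <- r) c j * fine (P (A j)))%:E)%E.
Proof.
move=> mA; under eq_integral do rewrite -sumEFin.
rewrite integral_sum//; last first.
  move=> j; have := integrableZl measurableT (c j) (integrable_indic P (mA j)).
  by apply: eq_integrable.
rewrite -sumEFin; apply: eq_bigr => j _.
under eq_integral do rewrite EFinM.
rewrite integralZl//; last exact: integrable_indic.
by rewrite integral_indic// setIT EFinM fineK// fin_num_measure.
Qed.

End indicator_combinations.

Section exchangeable_averages.
Context d (T : measurableType d) (R : realType) (P : probability T R).
Variables (E : nat -> set T) (a b : R).
Hypothesis mE : forall j, measurable (E j).
Hypothesis PE : forall j, P (E j) = a%:E.
Hypothesis PEE : forall i j, i <> j -> P (E i `&` E j) = b%:E.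

Definition average n (x : T) : R := n%:R^-1 * \sum_(j < n) \1_(E j) x.

Let coef n m j : R := m%:R^-1 - (if (j < n)%N then n%:R^-1 else 0).

Let averageB n m x : (n <= m)%N ->
  average m x - average n x = \sum_(j < m) coef n m j * \1_(E j) x.
Proof.
move=> nm; rewrite /average (big_ord_widen m (fun j => \1_(E j) x : R) nm).
rewrite [X in _ - _ * X]big_mkcond !mulr_sumr -sumrB; apply: eq_bigr => j _.
by rewrite /coef; case: ifP => _; ring.
Qed.

Let sum_coef n m : (0 < n)%N -> (n <= m)%N -> \sum_(j < m) coef n m j = 0.
Proof.
move=> n0 nm; rewrite sumrB -big_mkcond/= -(big_ord_widen m (fun=> n%:R^-1) nm).
rewrite !sumr_const !card_ord -(mulr_natr m%:R^-1 m) -(mulr_natr n%:R^-1 n).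
by rewrite !mulVf ?subrr// pnatr_eq0; lia.
Qed.

Let sum_coef_sqr n m : (0 < n)%N -> (n <= m)%N ->
  \sum_(j < m) coef n m j ^+ 2 = n%:R^-1 - m%:R^-1.
Proof.
move=> n0 nm.
have -> : \sum_(j < m) coef n m j ^+ 2 = \sum_(j < m) (m%:R^-1 ^+ 2 +
    (if (j < n)%N then n%:R^-1 ^+ 2 - 2 * m%:R^-1 * n%:R^-1 else 0)).
  by apply: eq_bigr => j _; rewrite /coef; case: ifP => _; ring.
rewrite big_split/= -big_mkcond/=.
rewrite -(big_ord_widen m (fun=> n%:R^-1 ^+ 2 - 2 * m%:R^-1 * n%:R^-1) nm).
rewrite !sumr_const !card_ord -(mulr_natr (m%:R^-1 ^+ 2) m).
rewrite -(mulr_natr (n%:R^-1 ^+ 2 - 2 * m%:R^-1 * n%:R^-1) n).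
have nn0 : n%:R != 0 :> R by rewrite pnatr_eq0; lia.
have mn0 : m%:R != 0 :> R by rewrite pnatr_eq0; lia.
by field; rewrite nn0 mn0.
Qed.

(** The probability of [E i] and [E j] together is [b], plus [a - b] when [i = j]. In the expanded
    square, [b] is multiplied by the square of the sum of the weights [coef], which is 0; what
    remains is [a - b] times the sum of their squares. *)
Lemma integral_averageB_sqr n m : (0 < n)%N -> (n <= m)%N ->
  (\int[P]_x ((average m x - average n x) ^+ 2)%:E =
   ((a - b) * (n%:R^-1 - m%:R^-1))%:E)%E.
Proof.
move=> n0 nm; set c := coef n m.
transitivity (\int[P]_x (\sum_(p : 'I_m * 'I_m) (c p.1 * c p.2) *
    \1_(E p.1 `&` E p.2) x)%:E)%E.
  apply: eq_integral => x _; rewrite averageB// expr2 big_distrlr/=.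
  rewrite pair_bigA/=; congr EFin; apply: eq_bigr => p _.
  by rewrite indicI/=; rewrite /c; ring.
rewrite integral_indic_comb; last by move=> p; exact: measurableI.
congr EFin.
transitivity (\sum_(p : 'I_m * 'I_m) (b * (c p.1 * c p.2) +
    (if p.1 == p.2 then (a - b) * (c p.1 * c p.2) else 0))).
  apply: eq_bigr => -[i j] _ /=; have [->|ij] := eqVneq i j.
    by rewrite setIid PE/=; ring.
  by rewrite PEE/=; [ring|move/val_inj/eqP; rewrite (negbTE ij)].
rewrite big_split/= -mulr_sumr.
rewrite -(pair_bigA _ (fun i j : 'I_m => c i * c j))/=.
rewrite -(pair_bigA _ (fun i j : 'I_m =>
  if i == j then (a - b) * (c i * c j) else 0))/=.
rewrite -big_distrlr/= sum_coef// mul0r mulr0 add0r -sum_coef_sqr// mulr_sumr.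
by apply: eq_bigr => i _; rewrite -big_mkcond/= (big_pred1 i).
Qed.

Lemma measurable_average n : measurable_fun setT (average n).
Proof.
apply: measurable_funM => //; apply: measurable_sum => j.
exact: measurable_indic.
Qed.

(* Since E (average n - average m)^2 = (a - b)(1/n - 1/m) for n <= m, AM-GM
   [2 |z| <= 2^k z^2 + 2^-k] bounds the mean increment from 4^k to 4^k.+1
   by 2^-k. *)
Lemma ae_cvg_average : {ae P, forall x, cvgn (fun k => average (4 ^ k)%N x)}.
Proof.
pose g k x := `|average (4 ^ k.+1)%N x - average (4 ^ k)%N x|.
pose c k : R := 2^-1 ^+ k.
have mg k : measurable_fun setT (g k).
  by apply/measurableT_comp => //; apply: measurable_funB; exact: measurable_average.
have ab : a - b <= 1.
  have : (P (E 0%N) <= 1)%E by exact: probability_le1.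
  have : (0 <= P (E 0%N `&` E 1%N))%E by [].
  by rewrite PE PEE// !lee_fin; lra.
have gc k : (\int[P]_x (g k x)%:E <= (c k)%:E)%E.
  set n := (4 ^ k)%N; set m := (4 ^ k.+1)%N.
  have n0 : (0 < n)%N by rewrite expn_gt0.
  have nm : (n <= m)%N by rewrite leq_exp2l.
  have mz : measurable_fun setT (fun x => (average m x - average n x) ^+ 2).
    by apply: measurable_funX; apply: measurable_funB; exact: measurable_average.
  apply: (@le_trans _ _ (\int[P]_x ((2 ^+ k / 2)%:E *
      ((average m x - average n x) ^+ 2)%:E + (c k / 2)%:E))%E).
    apply: ge0_le_integral => //.
    - by move=> x _; rewrite lee_fin; exact: normr_ge0.
    - exact/measurable_EFinP.
    - by apply: emeasurable_funD => //; apply: measurable_funeM; exact/measurable_EFinP.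
    move=> x _; rewrite -EFinM -EFinD lee_fin /g.
    set z := average _ _ - _; rewrite -[z ^+ 2]real_normK ?num_real//.
    have y0 : 0 <= `|z| by []; move: `|z| y0 => y y0.
    have t0 : 0 < 2 ^+ k :> R by rewrite exprn_gt0.
    have tc : 2 ^+ k * c k = 1 by rewrite /c -exprMn divff// expr1n.
    have c0 : 0 < c k by rewrite exprn_gt0// invr_gt0.
    move: (2 ^+ k) (c k) t0 tc c0 => t e t0 te e0.
    have : 0 <= t * (y - e) ^+ 2 by rewrite mulr_ge0 ?sqr_ge0// ltW.
    have -> : t * (y - e) ^+ 2 = t * y ^+ 2 - 2 * (t * e) * y + (t * e) * e by ring.
    by rewrite te; lra.
  rewrite ge0_integralD//; last 3 first.
  - by move=> x _; rewrite -EFinM lee_fin mulr_ge0 ?sqr_ge0// divr_ge0// exprn_ge0.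
  - by apply: measurable_funeM; exact/measurable_EFinP.
  - by move=> x _; rewrite lee_fin divr_ge0// exprn_ge0.
  rewrite ge0_integralZl//; last 2 first.
  - exact/measurable_EFinP.
  - by move=> x _; rewrite lee_fin sqr_ge0.
  rewrite integral_averageB_sqr// integral_cst//.
  rewrite [X in (_ + _ * X)%E](_ : _ = 1%E) ?mule1; last exact: probability_setT.
  rewrite -EFinM -EFinD lee_fin /n /m /c !natrX -!exprVn.
  have h4 : 4^-1 ^+ k = (2^-1 ^+ k) ^+ 2 :> R.
    by rewrite -exprM mulnC exprM; congr (_ ^+ k); field.
  have te : 2 ^+ k * 2^-1 ^+ k = 1 :> R by rewrite -exprMn divff// expr1n.
  rewrite exprS h4; have e0 : 0 < 2^-1 ^+ k :> R by rewrite exprn_gt0// invr_gt0.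
  have t0 : 0 < 2 ^+ k :> R by rewrite exprn_gt0.
  move: (2^-1 ^+ k) (2 ^+ k) te e0 t0 => e t te e0 t0.
  (* Since [t * e = 1] and [a - b <= 1], this term is at most [3/8 * e]; adding [e / 2] stays below
     [e]. *)
  have -> : t / 2 * ((a - b) * (e ^+ 2 - 4^-1 * e ^+ 2)) =
      (t * e) * e * (a - b) * (3 / 8) by field.
  by rewrite te mul1r; nra.
have coo : (\sum_(k <oo) (c k)%:E < +oo)%E.
  rewrite (_ : (fun n => (\sum_(0 <= k < n) (c k)%:E)%E) =
      (EFin \o series (geometric 1 2^-1)))//; last first.
    apply/funext => n; rewrite /= /series/= -sumEFin.
    by apply: eq_bigr => k _; rewrite /geometric/= mul1r.
  have hc : series (geometric 1 (2^-1 : R)) @ \oo --> (1 * (1 - 2^-1)^-1 : R).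
    by apply: cvg_geometric_series; rewrite ger0_norm; lra.
  by rewrite EFin_lim ?ltry//; apply/cvg_ex; eexists; exact: hc.
have := @ae_summable _ _ _ P g c mg (fun _ _ => normr_ge0 _) gc coo.
by apply: filterS => x /cvgn_of_summable_increments.
Qed.

End exchangeable_averages.

(** * Limiting frequencies of the edges *)

Lemma cvg_sum_seq (R : realType) (J : Type) (r : seq J) (u : J -> R^nat) (l : J -> R) :
  (forall j, u j @ \oo --> l j) ->
  (fun k => \sum_(j <- r) u j k) @ \oo --> \sum_(j <- r) l j.
Proof.
move=> ul; elim: r => [|j r IH].
  by rewrite big_nil; under eq_fun do rewrite big_nil; exact: cvg_cst.
by rewrite big_cons; under eq_fun do rewrite big_cons; exact: cvgD.
Qed.

Lemma cvg_prod_seq (R : realType) (J : Type) (r : seq J) (u : J -> R^nat) (l : J -> R) :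
  (forall j, u j @ \oo --> l j) ->
  (fun k => \prod_(j <- r) u j k) @ \oo --> \prod_(j <- r) l j.
Proof.
move=> ul; elim: r => [|j r IH].
  by rewrite big_nil; under eq_fun do rewrite big_nil; exact: cvg_cst.
by rewrite big_cons; under eq_fun do rewrite big_cons; exact: cvgM.
Qed.

Lemma le_limn_einf (R : realType) (u v : (\bar R)^nat) :
  (forall k, u k <= v k)%E -> (limn_einf u <= limn_einf v)%E.
Proof.
move=> uv; rewrite !limn_einf_lim; apply: lee_lim; [exact: is_cvg_einfs..|].
apply: nearW => n; apply: le_ereal_inf_tmp => _ [k nk <-].
by apply: le_trans (uv k); apply: ereal_inf_lbound; exists k.
Qed.

Lemma limn_einf_ge (R : realType) (u : R^nat) (l : R) (v : (\bar R)^nat) :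
  u @ \oo --> l -> (forall k, (u k)%:E <= v k)%E -> (l%:E <= limn_einf v)%E.
Proof.
move=> ul uv; have ulE : (EFin \o u) @ \oo --> l%:E.
  by apply: cvg_EFin => //; exact: nearW.
have [<- _] := cvg_limn_einf_sup ulE; exact: le_limn_einf.
Qed.

Lemma limn_einf_le (R : realType) (u : R^nat) (l : R) (v : (\bar R)^nat) :
  u @ \oo --> l -> (forall k, v k <= (u k)%:E)%E -> (limn_einf v <= l%:E)%E.
Proof.
move=> ul uv; have ulE : (EFin \o u) @ \oo --> l%:E.
  by apply: cvg_EFin => //; exact: nearW.
have [<- _] := cvg_limn_einf_sup ulE; exact: le_limn_einf.
Qed.

Lemma measurable_limn_einf d (T : measurableType d) (R : realType)
    (u : nat -> T -> \bar R) :
  (forall k, measurable_fun setT (u k)) ->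
  measurable_fun setT (fun x => limn_einf (u ^~ x)).
Proof.
move=> mu; apply: measurableT_comp => //.
apply: (@measurable_fun_limn_esup _ _ _ setT (fun k x => - u k x)%E) => k.
exact: measurableT_comp.
Qed.

Lemma sum_eq_mem (R : realType) (T : eqType) (W : seq T) (x : T) : uniq W ->
  \sum_(s <- W) (x == s)%:R = (x \in W)%:R :> R.
Proof.
elim: W => [|s W IH] /=; first by rewrite big_nil.
move=> /andP[sW /IH{}IH]; rewrite big_cons IH inE.
have [->|_] := eqVneq x s; last by rewrite add0r.
by rewrite (negbTE sW) addr0.
Qed.

Lemma cvg_pow4V (R : realType) (c : R) : (fun k => c / (4 ^ k)%:R) @ \oo --> (0 : R).
Proof.
rewrite (_ : (fun k => _) = geometric c (4^-1)); last first.
  by apply/funext => k; rewrite /geometric/= natrX exprVn.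
by apply: cvg_geometric; rewrite ger0_norm; lra.
Qed.

Section frequencies.
Variable R : realType.
Implicit Types (I : Network) (s : seq nat).

Definition freq (N : nat) s I : R := N%:R^-1 * \sum_(j < N) (canonize I j == s)%:R.

Lemma freq_ge0 N s I : 0 <= freq N s I.
Proof. by rewrite mulr_ge0 ?invr_ge0// sumr_ge0. Qed.

Lemma average_le1 N (b : nat -> bool) : N%:R^-1 * \sum_(j < N) (b j)%:R <= 1 :> R.
Proof.
have [->|N0] := posnP N; first by rewrite big_ord0 mulr0.
rewrite mulrC ler_pdivrMr ?ltr0n// mul1r.
apply: (@le_trans _ _ (\sum_(j < N) 1)); last by rewrite sumr_const card_ord.
by apply: ler_sum => j _; case: (b j).
Qed.

Lemma freq_le1 N s I : freq N s I <= 1.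
Proof. exact: (average_le1 N (fun j => canonize I j == s)). Qed.

Lemma sum_freq N I (W : seq (seq nat)) : uniq W ->
  \sum_(s <- W) freq N s I = N%:R^-1 * \sum_(j < N) (canonize I j \in W)%:R.
Proof.
move=> uW; rewrite -mulr_sumr exchange_big/=; congr (_ * _).
by apply: eq_bigr => j _; exact: sum_eq_mem.
Qed.

Lemma measurable_freq N s : measurable_fun setT (freq N s).
Proof.
apply: measurable_funM => //; apply: measurable_sum => j.
have -> : (fun I => (canonize I j == s)%:R) =
    \1_[set I : Network | canonize I j = s] :> (Network -> R).
  apply/funext => I; rewrite indicE; congr ((_ : bool)%:R).
  by apply/eqP/idP => [e|]; [exact/mem_set|move/set_mem].
apply: measurable_indic; apply: (@determined_measurable j.+1).
exact: determined_canonize.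
Qed.

(** An upper limit is defined and measurable on every network; [regular] below says that it is a
    true limit. *)
Definition limfreq s I : R := limn_sup (fun k => freq (4 ^ k)%N s I).

Let freq_bounded s I : has_ubound (range (fun k => freq (4 ^ k)%N s I)).
Proof. by exists 1 => _ [k _ <-]; exact: freq_le1. Qed.

Let freq_lbounded s I : has_lbound (range (fun k => freq (4 ^ k)%N s I)).
Proof. by exists 0 => _ [k _ <-]; exact: freq_ge0. Qed.

Lemma measurable_limfreq s : measurable_fun setT (limfreq s).
Proof.
apply: (@measurable_fun_limn_sup _ _ _ setT (fun k => freq (4 ^ k)%N s)) => *.
- exact: freq_bounded.
- exact: freq_lbounded.
exact: measurable_freq.
Qed.

Lemma limfreq_ge0 s I : 0 <= limfreq s I.
Proof.
apply: limr_ge.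
  apply/cvg_ex; eexists; apply: cvg_sups_inf => //.
apply: nearW => n; apply: (@le_trans _ _ (freq (4 ^ n)%N s I)); first exact: freq_ge0.
by apply: ub_le_sup; [exact/has_ubound_sdrop|exists n => /=].
Qed.

Definition mass I : \bar R := \esum_(s in [set: seq nat]) (limfreq s I)%:E.

Lemma measurable_mass : measurable_fun setT mass.
Proof.
pose h n I := opickled setT 0%E (fun s => (limfreq s I)%:E) n.
have -> : mass = (fun I => \sum_(n <oo) h n I)%E.
  apply/funext => I; rewrite /mass esum_series// => s.
  by rewrite lee_fin limfreq_ge0.
apply: ge0_emeasurable_sum => n.
  move=> I _ _; rewrite /h /opickled; case: pickle_inv => // s.
  by case: ifP => // _; rewrite lee_fin limfreq_ge0.
move=> _; rewrite /h /opickled; case: pickle_inv => [s|]; last exact: measurable_cst.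
by rewrite in_setT; apply/measurable_EFinP; exact: measurable_limfreq.
Qed.

Definition regular I := forall s, (fun k => freq (4 ^ k)%N s I) @ \oo --> limfreq s I.

(** The frequencies of finitely many words add up to at most 1, and this passes to the limit. True
    limits are used because upper limits are only subadditive. *)
Lemma regular_mass_le1 I : regular I -> (mass I <= 1)%E.
Proof.
move=> rI; apply: ge_ereal_sup => _ [W [finW _] <-].
rewrite fsbig_finite//= sumEFin lee_fin.
apply: (cvgr_to_le (cvg_sum_seq (r := finmap.enum_fset (fset_set W)) rI)).
apply: nearW => k; rewrite sum_freq//; last exact: finmap.fset_uniq.
exact: (average_le1 _ (fun j => canonize I j \in finmap.enum_fset (fset_set W))).
Qed.

Lemma mass_ge_sum I (W : seq (seq nat)) : uniq W ->
  ((\sum_(s <- W) limfreq s I)%:E <= mass I)%E.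
Proof.
move=> uW; apply: esum_ge; exists [set` W].
  by split=> //; exact: finite_seq.
by rewrite -fsbig_seq// sumEFin.
Qed.

End frequencies.

Lemma measurable_blip_free : measurable [set I : Network | blip_free I].
Proof.
have -> : [set I : Network | blip_free I] = \bigcap_i \bigcup_j
    (if j == i then set0 else [set I : Network | I j = I i]).
  apply/seteqP; split=> I bI i => [_|].
    by have [j [/eqP ji Ij]] := bI i; exists j => //; rewrite (negbTE ji).
  have [j _] := bI i Logic.I; case: eqP => // ji Ij.
  by exists j.
apply: bigcapT_measurable => i; apply: bigcupT_measurable => j.
case: eqP => // _; apply: (@determined_measurable (maxn i j).+1).
by apply: determined_eq; rewrite ltnS ?leq_maxl ?leq_maxr.
Qed.

(** * Almost sure existence of the limiting frequencies *)

Section edge_exchangeable.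
Variables (R : realType) (Q : probability Network R).
Hypothesis Qexch : forall sigma sinv : nat -> nat,
  cancel sigma sinv -> cancel sinv sigma -> forall A : set Network, measurable A ->
  Q [set I | A (edge_relabel sinv I)] = Q A.

(** Extend [tau] to a permutation: [A] only sees the first [n] edges, where the two agree. *)
Lemma exch_injection n (A : set Network) (tau : nat -> nat) :
  determined n A -> {in gtn n &, injective tau} ->
  Q [set I | A (edge_relabel tau I)] = Q A.
Proof.
move=> dA /extend_injection[s [sinv [sK sinvK sE]]].
rewrite -(Qexch sinvK sK (determined_measurable dA)); congr (Q _).
by apply/seteqP; split=> I; apply: dA; apply: eq_restr_eq => i lt_in;
  rewrite /edge_relabel sE.
Qed.

(** Equality with a fixed edge [m] does not involve vertex names, so injections carrying edges 0, 1,
    2 to [m] and two later edges show that these events have constant one- and two-point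
    probabilities [a] and [b]. *)
Lemma ae_cvg_recurrence m :
  {ae Q, forall I, cvgn (fun k => average R
    (fun j => [set I : Network | I (m + j).+1 = I m]) (4 ^ k)%N I)}.
Proof.
pose a := fine (Q [set I : Network | I 1%N = I 0%N]).
pose b := fine (Q ([set I : Network | I 1%N = I 0%N] `&` [set I | I 2%N = I 0%N])).
have d1 n : (1 < n)%N -> determined n [set I : Network | I 1%N = I 0%N].
  by move=> n1; apply: determined_eq => //; exact: ltnW.
have d2 : determined 3 ([set I : Network | I 1%N = I 0%N] `&` [set I | I 2%N = I 0%N]).
  by apply: determinedI; [exact: d1|exact: determined_eq].
apply: (@ae_cvg_average _ _ _ _ _ a b).
- move=> j; apply: (@determined_measurable (m + j).+2).
  by apply: determined_eq => //; rewrite ltnS leqW// leq_addr.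
- move=> j; rewrite fineK ?fin_num_measure//; last exact: determined_measurable (d1 2 isT).
  pose tau i := if i == 0%N then m else (m + j).+1.
  rewrite -(@exch_injection 2 _ tau (d1 2 isT))//.
  by move=> [|[|i]] [|[|i']]; rewrite !inE// /tau/=; lia.
- move=> i j ij; rewrite fineK ?fin_num_measure//; last exact: determined_measurable d2.
  pose tau l := if l == 0%N then m else if l == 1%N then (m + i).+1 else (m + j).+1.
  rewrite -(@exch_injection 3 _ tau d2)//.
  by move=> [|[|[|l]]] [|[|[|l']]]; rewrite !inE// /tau/=; lia.
Qed.

(** Shifting a window of length [N] by [m] trades [m] terms for [m] others, a negligible change
    after division by [N]. *)
Lemma sum_shift (x : nat -> R) m N :
  \sum_(j < N) x j =
  \sum_(j < N) x (m + j)%N + \sum_(j < m) (x j - x (N + j)%N).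
Proof.
have e1 : \sum_(j < m + N) x j = \sum_(j < m) x j + \sum_(j < N) x (m + j)%N.
  by rewrite big_split_ord.
have e2 : \sum_(j < m + N) x j = \sum_(j < N) x j + \sum_(j < m) x (N + j)%N.
  by rewrite addnC big_split_ord.
by rewrite sumrB; move: e1 e2; lra.
Qed.

Lemma cvg_regular I s (l : R) :
  (fun k => freq R (4 ^ k)%N s I) @ \oo --> l ->
  (fun k => freq R (4 ^ k)%N s I) @ \oo --> limfreq R s I.
Proof. by move=> h; have [_ e] := cvg_limn_inf_sup h; rewrite /limfreq e. Qed.

(** A word that names no edge has frequency 0. If [s] names edge [m], then edge [j] carries [s]
    exactly when it equals edge [m], so the frequency is a recurrence average up to boundary terms.
    Countably many [m] give a single null set. *)
Lemma ae_regular : {ae Q, forall I, regular R I}.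
Proof.
have := ae_foralln ae_cvg_recurrence; apply: filterS => I cI s.
have [[m sm]|ns] := pselect (exists m, canonize I m = s); last first.
  apply: (@cvg_regular _ _ 0).
  have -> : (fun k => freq R (4 ^ k)%N s I) = cst 0.
    apply/funext => k; rewrite /freq big1 ?mulr0// => j _.
    by case: eqP => // js; case: ns; exists j.
  exact: cvg_cst.
have /cvg_ex[l hl] := cI m.
apply: (@cvg_regular _ _ (l + 0)).
pose x j : R := (I j == I m)%:R.
pose D k := \sum_(j < m.+1) (x j - x (4 ^ k + j)%N).
have -> : (fun k => freq R (4 ^ k)%N s I) = (fun k => average R
    (fun j => [set I : Network | I (m + j).+1 = I m]) (4 ^ k)%N I +
    D k / (4 ^ k)%:R).
  apply/funext => k; rewrite /freq /average -sm.
  under eq_bigr do rewrite canonize_eq -/(x _).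
  rewrite (sum_shift x m.+1) mulrDr -/(D k) [D k / _]mulrC; congr (_ * _ + _).
  apply: eq_bigr => j _; rewrite indicE /x addSn; congr ((_ : bool)%:R).
  by apply/eqP/idP => [e|]; [exact/mem_set|move/set_mem].
apply: cvgD hl _.
apply: (@squeeze_cvgr _ _ _ _ (fun k => - m.+1%:R / (4 ^ k)%:R)
  (fun k => m.+1%:R / (4 ^ k)%:R)); [|exact: cvg_pow4V..].
apply: nearW => k; have p0 : 0 < (4 ^ k)%:R :> R by rewrite ltr0n expn_gt0.
suff : `|D k| <= m.+1%:R.
  by rewrite ler_norml => /andP[h1 h2]; rewrite !ler_pM2r ?invr_gt0// h1 h2.
apply: le_trans (ler_norm_sum _ _ _) _.
apply: (@le_trans _ _ (\sum_(j < m.+1) 1)); last by rewrite sumr_const card_ord.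
apply: ler_sum => j _; rewrite /x.
by case: eqP => _; case: eqP => _; rewrite ?subrr ?subr0 ?sub0r ?normrN ?normr0 ?normr1.
Qed.

(** * Total mass of the limiting frequencies *)

Definition seen_before m : set Network := [set I | exists2 i, (i < m)%N & I i = I m].

Lemma determined_seen m j n : (m <= n)%N -> (j < n)%N ->
  determined n [set I | exists2 i, (i < m)%N & I i = I j].
Proof.
move=> le_mn lt_jn I J IJ [i lt_im Iij]; exists i => //.
by apply: (determined_eq _ _ IJ) => //; exact: leq_trans le_mn.
Qed.

(** For [j < m] the right-hand event is certain. Otherwise moving edge [m] to [j], with the edges
    below [m] fixed, gives equality. *)
Lemma seen_before_le m j :
  (Q (seen_before m) <= Q [set I | exists2 i, (i < m)%N & I i = I j])%E.
Proof.
have [jm|mj] := ltnP j m.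
  rewrite [X in (_ <= Q X)%E](_ : _ = setT); last first.
    by apply/seteqP; split=> // I _; exists j.
  rewrite [X in (_ <= X)%E](_ : _ = 1%E); last exact: probability_setT.
  apply: probability_le1; apply: determined_measurable.
  exact: (@determined_seen m m m.+1).
pose tau i := if i == m then j else i.
rewrite -(@exch_injection m.+1 (seen_before m) tau); last 2 first.
- exact: determined_seen.
- by move=> i i'; rewrite !inE /tau; case: eqP; case: eqP; lia.
rewrite le_eqVlt; apply/orP; left; apply/eqP; congr (Q _).
rewrite /seen_before /edge_relabel /tau /=.
apply/seteqP; split=> I /= [i lt_im].
  by rewrite eqxx (ltn_eqF lt_im) => h; exists i.
by move=> h; exists i => //; rewrite eqxx (ltn_eqF lt_im).
Qed.

Hypothesis Qblip : Q [set I : Network | blip_free I] = 1%E.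

Lemma seen_before_cvg1 : (fun m => Q (seen_before m)) @ \oo --> 1%E.
Proof.
pose F m : set Network := [set I | exists2 i, (i < m)%N & I i.+1 = I 0%N].
have dF m : determined m.+1 (F m).
  move=> I J IJ [i lt_im Ii]; exists i => //.
  by apply: (determined_eq _ _ IJ).
have mF m : measurable (F m) by apply: determined_measurable (dF m).
have -> : (fun m => Q (seen_before m)) = Q \o F.
  (* Edge 0 is put in place of edge [m], and edges 1 to [m] in place of the earlier ones. *)
  apply/funext => m /=; pose tau i := if i == m then 0%N else i.+1.
  rewrite -(@exch_injection m.+1 (seen_before m) tau); last 2 first.
  - exact: determined_seen.
  - by move=> i i'; rewrite !inE /tau; case: eqP; case: eqP; lia.
  rewrite /seen_before /edge_relabel /tau /F /=; congr (Q _).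
  apply/seteqP; split=> I /= [i lt_im].
    by rewrite eqxx (ltn_eqF lt_im) => h; exists i.
  by move=> h; exists i => //; rewrite eqxx (ltn_eqF lt_im).
have mU : measurable (\bigcup_m F m) by exact: bigcupT_measurable.
have -> : 1%E = Q (\bigcup_m F m).
  apply/eqP; rewrite eq_le probability_le1// andbT -Qblip.
  apply: le_measure; rewrite ?inE//; first exact: measurable_blip_free.
  move=> I /(_ 0%N)[[|j] [j0 Ij]]; first by case: j0.
  by exists j.+1 => //; exists j.
apply: nondecreasing_cvg_mu => // m n mn; apply/subsetPset => I [i lt_im Ii].
by exists i => //; exact: leq_trans mn.
Qed.

(** On a regular network this tends, in [k], to 1 minus the limiting mass of the first [m] edges,
    hence to an upper bound of the missing mass; its mean is controlled uniformly in [k]. *)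
Let unseen m k (I : Network) : R := 1 - (4 ^ k)%:R^-1 * \sum_(j < 4 ^ k) (I j \in initseg m I)%:R.

Let unseenE m k (I : Network) : unseen m k I = \sum_(j < 4 ^ k)
  (4 ^ k)%:R^-1 * \1_(~` [set I : Network | exists2 i, (i < m)%N & I i = I j]) I.
Proof.
rewrite /unseen -mulr_sumr; transitivity ((4 ^ k)%:R^-1 * \sum_(j < 4 ^ k) (1 : R) -
  (4 ^ k)%:R^-1 * \sum_(j < 4 ^ k) (I j \in initseg m I)%:R).
  by rewrite sumr_const card_ord mulVf// pnatr_eq0 expn_eq0.
rewrite -mulrBr -sumrB; congr (_ * _); apply: eq_bigr => j _.
rewrite indicE in_setC -[X in X - _]/(true%:R).
have -> : (I j \in initseg m I) =
    (I \in [set I : Network | exists2 i, (i < m)%N & I i = I j]).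
  apply/mapP/idP => [[i]|/set_mem[i lt_im Iij]]; last by exists i; rewrite ?mem_iota.
  by rewrite mem_iota => /= lt_im Iij; apply/mem_set; exists i.
by case: (_ \in _); rewrite ?subrr ?subr0.
Qed.

Let measurable_unseen m k : measurable_fun setT (unseen m k).
Proof.
rewrite (_ : unseen m k = (fun I => \sum_(j < 4 ^ k) (4 ^ k)%:R^-1 *
  \1_(~` [set I : Network | exists2 i, (i < m)%N & I i = I j]) I)); last first.
  by apply/funext => I; exact: unseenE.
apply: measurable_sum => j; apply: measurable_funM => //.
apply: measurable_indic; apply: measurableC.
apply: (@determined_measurable (maxn m j.+1)); apply: determined_seen.
  exact: leq_maxl.
by rewrite leq_max ltnSn orbT.
Qed.

Let unseen_ge0 m k (I : Network) : 0 <= unseen m k I.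
Proof. by rewrite subr_ge0; exact: (average_le1 R _ (fun j => I j \in initseg m I)). Qed.

Let integral_unseen m k :
  (\int[Q]_I (unseen m k I)%:E <= (1 - fine (Q (seen_before m)))%:E)%E.
Proof.
pose S (j : 'I_(4 ^ k)) := [set I : Network | exists2 i, (i < m)%N & I i = I j].
have mS j : measurable (S j).
  apply: (@determined_measurable (maxn m j.+1)); apply: determined_seen.
    exact: leq_maxl.
  by rewrite leq_max ltnSn orbT.
have mB : measurable (seen_before m).
  by apply: (@determined_measurable m.+1); exact: determined_seen.
under eq_integral do rewrite unseenE.
rewrite (integral_indic_comb Q _ (fun=> (4 ^ k)%:R^-1) (A := fun j => ~` S j)); last first.
  by move=> j; exact: measurableC.
rewrite lee_fin -mulr_sumr mulrC ler_pdivrMr ?ltr0n ?expn_gt0//.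
apply: (@le_trans _ _ (\sum_(j < 4 ^ k) (1 - fine (Q (seen_before m))))); last first.
  by rewrite sumr_const card_ord mulr_natr.
apply: ler_sum => j _; rewrite probability_setC// fineB ?fin_num_measure//= lerD2l lerN2.
by apply: fine_le; rewrite ?fin_num_measure//; exact: seen_before_le.
Qed.

Lemma ae_mass1 : {ae Q, forall I, mass R I = 1%E}.
Proof.
(* The positive part is taken because [mass] is known to be at most 1 only on regular networks.
   Fatou in [k] bounds the mean of [delta] for each [m]; then [m] tends to infinity. *)
pose delta I := maxe 0%E (1 - mass R I)%E.
have mdelta : measurable_fun setT delta.
  apply: measurable_maxe => //; apply: emeasurable_funB => //.
  exact: measurable_mass.
have delta0 I : (0 <= delta I)%E by rewrite le_max lexx.
have le_delta m : (\int[Q]_I delta I <= (1 - fine (Q (seen_before m)))%:E)%E.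
  have := @fatou _ _ _ Q setT measurableT (fun k I => (unseen m k I)%:E).
  move=> /(_ _ _)/le_trans h.
  apply: le_trans (h _ _ _ _).
  - apply: ae_ge0_le_integral => //.
    + by move=> I _; apply: (limn_einf_ge (u := cst 0)) => [|k]; [exact: cvg_cst|rewrite lee_fin].
    + apply: measurable_limn_einf => k; exact/measurable_EFinP.
    have := ae_regular; apply: filterS => I rI _.
    (* Frequencies are indexed by canonical names, and [mass] counts each name once. *)
    pose W := undup (initseg m (canonize I)).
    have uW : uniq W by exact: undup_uniq.
    have hW := cvg_sum_seq (r := W) rI.
    have unseenW k : unseen m k I = 1 - \sum_(s <- W) freq R (4 ^ k)%N s I.
      rewrite sum_freq// /unseen; congr (1 - _ * _); apply: eq_bigr => j _.
      congr ((_ : bool)%:R); rewrite mem_undup.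
      apply/mapP/mapP => -[i im /eqP e]; exists i => //; apply/eqP.
        by rewrite canonize_eq.
      by rewrite -canonize_eq.
    rewrite /delta ge_max; apply/andP; split.
      by apply: (limn_einf_ge (u := cst 0)) => [|k]; [exact: cvg_cst|rewrite lee_fin].
    apply: (@le_trans _ _ (1 - \sum_(s <- W) limfreq R s I)%:E).
      by rewrite EFinB leeB// mass_ge_sum.
    have h1 : (fun k => 1 - \sum_(s <- W) freq R (4 ^ k)%N s I) @ \oo -->
        1 - \sum_(s <- W) limfreq R s I by apply: cvgB => //; exact: cvg_cst.
    by apply: (limn_einf_ge h1) => k; rewrite lee_fin unseenW.
  - by move=> k; exact/measurable_EFinP.
  - by move=> k I _; rewrite lee_fin.
  apply: (@limn_einf_le _ (cst (1 - fine (Q (seen_before m))))) => [|k].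
    exact: cvg_cst.
  exact: integral_unseen.
have int0 : (\int[Q]_I delta I = 0)%E.
  apply/eqP; rewrite eq_le integral_ge0// andbT.
  have h : (fun m => (1 - fine (Q (seen_before m)))%:E) @ \oo --> (1 - 1 : R)%:E.
    apply: cvg_EFin; first exact: nearW.
    by apply: cvgB; [exact: cvg_cst|exact: fine_cvg seen_before_cvg1].
  rewrite subrr in h; apply: (cvge_to_ge h); exact: nearW.
have := (ae_eq_integral_abs Q measurableT mdelta).1.
under eq_integral do rewrite gee0_abs//.
move=> /(_ int0); have := ae_regular; apply: filterS2 => I rI /(_ Logic.I) d0.
apply/eqP; rewrite eq_le regular_mass_le1//=.
have : (1 - mass R I <= 0)%E by rewrite -[leRHS]d0 le_max lexx orbT.
by rewrite sube_le0.
Qed.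

End edge_exchangeable.

(** * The mixture *)

Lemma measurable_F1_coord (R : realType) s :
  measurable_fun [set: F1space R] (fun f : F1space R => F1val f s).
Proof. by move=> _ B mB; rewrite setTI; apply: sub_sigma_algebra; exists s, B. Qed.

Lemma measurable_to_F1 d (T : measurableType d) (R : realType) (F : T -> F1space R) :
  (forall s, measurable_fun [set: T] (fun x => F1val (F x) s)) ->
  measurable_fun [set: T] F.
Proof.
move=> mF; apply: (@measurability _ _ T (F1space R) setT F (@F1_generators R)) => //.
by move=> _ [_ [s [B [mB ->]]] <-]; exact: mF.
Qed.

(** The probability is a countable sum, over words, of finite products of coordinates of [f]. *)
Lemma determined_measurable_epsilon (R : realType) n (A : set Network) :
  determined n A -> measurable_fun [set: F1space R] (fun f : F1space R => epsilon f A).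
Proof.
move=> dA; pose D := [set w : seq (seq nat) | size w = n /\ A (pad w)].
pose h k (f : F1space R) := opickled D 0%E (fun w => (wmass f w)%:E) k.
have -> : (fun f : F1space R => epsilon f A) = (fun f => \sum_(k <oo) h k f)%E.
  apply/funext => f; rewrite (epsilon_determined _ dA) esum_series// => w.
  by rewrite lee_fin wmass_ge0.
apply: ge0_emeasurable_sum => k.
  move=> f _ _; rewrite /h /opickled; case: pickle_inv => // w.
  by case: ifP => // _; rewrite lee_fin wmass_ge0.
move=> _; rewrite /h /opickled; case: pickle_inv => [w|]; last exact: measurable_cst.
case: (w \in D); last exact: measurable_cst.
apply/measurable_EFinP; apply: measurable_prod => s _.
exact: measurable_F1_coord.
Qed.

Lemma measurable_epsilon (R : realType) (A : set Network) : measurable A ->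
  measurable_fun [set: F1space R] (fun f : F1space R => epsilon f A).
Proof.
rewrite measurable_NetworkE; move: A.
apply: (@dynkin_induction _ Network) => //.
- exact: measurable_NetworkE.
- exact: cylinder_setI_closed.
- by rewrite (_ : (fun f => _) = cst 1%E)//; apply/funext => f; exact: probability_setT.
- move=> _ [[n [I ->]]|->].
    exact: determined_measurable_epsilon (@determined_cylinder n I).
  by rewrite (_ : (fun f => _) = cst 0%E)//; apply/funext => f; exact: measure0.
- move=> S mS hS; rewrite (_ : (fun f => _) = (fun f => 1 - epsilon f S)%E).
    exact: emeasurable_funB.
  by apply/funext => f; rewrite probability_setC.
- move=> F mF tF hF.
  rewrite (_ : (fun f => _) = (fun f : F1space R => \sum_(k <oo) epsilon f (F k))%E).
    exact: ge0_emeasurable_sum.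
  by apply/funext => f; rewrite measure_semi_bigcup//; exact: bigcupT_measurable.
Qed.

(** A form without division of the bound [n^2 / N] on the proportion of non-injective maps from
    [[n]] to [[N]]. *)
Lemma expn_le_ffact n N : (N * N ^ n <= N * N ^_ n + n ^ 2 * N ^ n)%N.
Proof.
elim: n => [|n IH]; first by rewrite ffactn0 expn0 muln1 leq_addr.
(* An injective choice of [n] values has at most [n] non-injective extensions by one more value. *)
have h1 : (N * N ^_ n <= N ^_ n.+1 + n * N ^ n)%N.
  have h2 : (N ^_ n <= N ^ n)%N.
    elim: n {IH} => [|n IHn]; first by rewrite ffactn0.
    by rewrite ffactnSr expnSr leq_mul// leq_subr.
  rewrite ffactnSr; have [lt|le] := ltnP N n; first by nia.
  by nia.
rewrite !expnS; set x := (N ^ n)%N in IH h1 *; set y := (N ^_ n)%N in IH h1 *.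
set z := (N ^_ n.+1)%N in h1 *; nia.
Qed.

Section mixture.
Variables (R : realType) (Q : probability Network R).
Hypothesis Qexch : forall sigma sinv : nat -> nat,
  cancel sigma sinv -> cancel sinv sigma -> forall A : set Network, measurable A ->
  Q [set I | A (edge_relabel sinv I)] = Q A.
Hypothesis Qblip : Q [set I : Network | blip_free I] = 1%E.

(** Elements of [F1] carry a proof of total mass 1, so networks where it fails, a null set by
    [ae_mass1], go to a fixed point. *)
Definition directing (I : Network) : F1space R :=
  if pselect (isF1 (fun s => limfreq R s I)) is left p then MkF1 p
  else MkF1 (@f1_point_P R).

Lemma directingE I s : mass R I = 1%E -> F1val (directing I) s = limfreq R s I.
Proof.
move=> mI; rewrite /directing; case: pselect => // -[]; split=> // {}s.
exact: limfreq_ge0.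
Qed.

Lemma measurable_directing : measurable_fun [set: Network] directing.
Proof.
apply: measurable_to_F1 => s.
have -> : (fun I => F1val (directing I) s) =
    (fun I => if mass R I == 1%E then limfreq R s I else f1_point_fun R s).
  apply/funext => I; case: eqP => [mI|mI]; first exact: directingE.
  by rewrite /directing; case: pselect => // p; have [_ /mI] := p.
apply: measurable_fun_ifT => //; last exact: measurable_limfreq.
apply: (measurable_fun_bool true) => /=; rewrite setTI.
have -> : (fun I => mass R I == 1%E) @^-1` [set true] = mass R @^-1` [set 1%E].
  by apply/seteqP; split=> I /= /eqP.
by rewrite -[X in measurable X]setTI; exact: measurable_mass.
Qed.

Lemma measurable_epsilon_directing (B : set Network) : measurable B ->
  measurable_fun [set: Network] (fun I => epsilon (directing I) B).
Proof.
move=> mB; apply: (@measurableT_comp _ _ _ _ _ _ (fun f : F1space R => epsilon f B)).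
  exact: measurable_epsilon.
exact: measurable_directing.
Qed.

Section determined_event.
Variables (n : nat) (A : set Network).
Hypothesis dA : determined n A.

Definition extend_ffun N (tau : {ffun 'I_n -> 'I_N}) (i : nat) : nat :=
  if insub i is Some j then val (tau j) else 0%N.

Lemma extend_ffunE N (tau : {ffun 'I_n -> 'I_N}) (j : 'I_n) :
  extend_ffun tau j = tau j.
Proof. by rewrite /extend_ffun valK. Qed.

Let sampled N (tau : {ffun 'I_n -> 'I_N}) : set Network :=
  [set I | A (edge_relabel (extend_ffun tau) I)].

Let sampled_determined N (tau : {ffun 'I_n -> 'I_N}) : determined N (sampled tau).
Proof.
apply: (determined_relabel _ dA) => i lt_in.
by rewrite -[i]/(val (Ordinal lt_in)) extend_ffunE.
Qed.

(** For [N > 0], the conditional probability given [I] that [n] edges drawn with replacement from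
    the first [N] form a network in [A]. *)
Definition sampling N (I : Network) : R :=
  \sum_(tau : {ffun 'I_n -> 'I_N}) N%:R^-1 ^+ n * \1_(sampled tau) I.

Lemma sampling_ge0 N I : 0 <= sampling N I.
Proof. by apply: sumr_ge0 => tau _; rewrite mulr_ge0// exprn_ge0// invr_ge0. Qed.

Lemma measurable_sampling N : measurable_fun [set: Network] (sampling N).
Proof.
apply: measurable_sum => tau; apply: measurable_funM => //.
by apply: measurable_indic; exact: determined_measurable (@sampled_determined N tau).
Qed.

Let sampled_word N (tau : {ffun 'I_n -> 'I_N}) (I : Network) :=
  [seq canonize I (tau j) | j <- enum 'I_n].

Let size_sampled_word N (tau : {ffun 'I_n -> 'I_N}) I : size (sampled_word tau I) = n.
Proof. by rewrite size_map size_enum_ord. Qed.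

Let nth_sampled_word N (tau : {ffun 'I_n -> 'I_N}) I (j : 'I_n) :
  nth [::] (sampled_word tau I) j = canonize I (tau j).
Proof. by rewrite (nth_map j) ?size_enum_ord// nth_ord_enum. Qed.

(** Distributing the product of averages amounts to choosing one edge for each letter of [w]. *)
Lemma prod_freq N I (w : seq (seq nat)) : size w = n ->
  \prod_(s <- w) freq R N s I =
  \sum_(tau : {ffun 'I_n -> 'I_N}) N%:R^-1 ^+ n * (sampled_word tau I == w)%:R.
Proof.
move=> sw; rewrite (big_nth [::]) sw big_mkord big_split/= prodr_const card_ord.
rewrite bigA_distr_bigA/= mulr_sumr; apply: eq_bigr => tau _; congr (_ * _).
have [<-|ne] := eqVneq.
  by rewrite big1// => j _; rewrite nth_sampled_word eqxx.
have [j nej] : exists j : 'I_n, canonize I (tau j) != nth [::] w j.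
  apply: contrapT => /forallNP h; move/eqP: ne; apply.
  apply: (@eq_from_nth _ [::]); rewrite ?sw ?size_sampled_word// => i lt_in.
  rewrite -[i]/(val (Ordinal lt_in)) nth_sampled_word.
  by apply/eqP; have /negP := h (Ordinal lt_in); rewrite negbK.
by rewrite (bigD1 j)//= (negbTE nej) mul0r.
Qed.

(** Each [tau] produces a single word. If that word is in [W], the sampled edges lie in [A], because
    canonizing the first [N] edges renames the vertices of all sampled edges by one bijection. *)
Lemma sum_prod_freq_le N I (W : seq (seq (seq nat))) : uniq W ->
  (forall w, w \in W -> size w = n /\ A (pad w)) ->
  \sum_(w <- W) \prod_(s <- w) freq R N s I <= sampling N I.
Proof.
move=> uW WA.
have -> : \sum_(w <- W) \prod_(s <- w) freq R N s I = \sum_(w <- W)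
    \sum_(tau : {ffun 'I_n -> 'I_N}) N%:R^-1 ^+ n * (sampled_word tau I == w)%:R.
  by rewrite !big_seq; apply: eq_bigr => w /WA[sw _]; exact: prod_freq.
rewrite exchange_big/=; apply: ler_sum => tau _; rewrite -mulr_sumr.
apply: ler_wpM2l; first by rewrite exprn_ge0// invr_ge0.
rewrite sum_eq_mem// indicE; have [inW|//] := boolP (_ \in W).
have [_ Aw] := WA _ inW.
suff -> : I \in sampled tau by [].
apply/mem_set; rewrite /sampled/=; move: Aw; apply: dA.
apply: restr_eq_trans (_ : restr_eq n _ (edge_relabel (extend_ffun tau) (canonize I))) _.
  apply: eq_restr_eq => i lt_in; rewrite -[i]/(val (Ordinal lt_in)).
  by rewrite /pad nth_sampled_word /edge_relabel extend_ffunE.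
apply: (@restr_eq_relabel _ N).
  move=> i lt_in; rewrite -[i]/(val (Ordinal lt_in)) extend_ffunE; exact: ltn_ord.
exact/restr_eq_sym/canonize_restr_eq.
Qed.

(** An injective [tau] contributes [Q A] by exchangeability; each other [tau] contributes at most 1,
    and their proportion is at most [n^2 / N]. *)
Lemma integral_sampling N : (0 < N)%N ->
  (\int[Q]_I (sampling N I)%:E <= (fine (Q A) + (n ^ 2)%:R / N%:R)%:E)%E.
Proof.
move=> N0; rewrite integral_indic_comb; last first.
  by move=> tau; exact: determined_measurable (@sampled_determined N tau).
rewrite lee_fin.
have mA : measurable A by exact: determined_measurable dA.
have qA0 : 0 <= fine (Q A) by rewrite fine_ge0.
have le_tau (tau : {ffun 'I_n -> 'I_N}) :
    fine (Q (sampled tau)) <= fine (Q A) + (~~ injectiveb tau)%:R.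
  have [/injectiveP tauI|_] /= := boolP (injectiveb tau).
    rewrite addr0 /sampled (exch_injection Qexch dA)// => i j.
    rewrite !inE => lt_in lt_jn.
    rewrite -[i]/(val (Ordinal lt_in)) -[j]/(val (Ordinal lt_jn)) !extend_ffunE.
    by move=> /val_inj/tauI ->.
  apply: (@le_trans _ _ 1); last by rewrite lerDr.
  rewrite -lee_fin fineK; last first.
    by rewrite fin_num_measure//; exact: determined_measurable (@sampled_determined N tau).
  by apply: probability_le1; exact: determined_measurable (@sampled_determined N tau).
rewrite -mulr_sumr.
have cardF : #|{: {ffun 'I_n -> 'I_N}}| = (N ^ n)%N by rewrite card_ffun !card_ord.
have cardI : #|[set tau : {ffun 'I_n -> 'I_N} | injectiveb tau]%SET| = (N ^_ n)%N.
  by rewrite card_inj_ffuns !card_ord.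
have sumI : \sum_(tau : {ffun 'I_n -> 'I_N}) (~~ injectiveb tau)%:R =
    (N ^ n - N ^_ n)%N%:R :> R.
  rewrite -natr_sum; congr (_%:R); rewrite -cardF -cardI.
  rewrite -(cardsC [set tau : {ffun 'I_n -> 'I_N} | injectiveb tau]%SET) addKn.
  rewrite -sum1_card [RHS]big_mkcond/=; apply: eq_bigr => tau _.
  by rewrite !inE; case: injectiveb.
have N0R : 0 < N%:R :> R by rewrite ltr0n.
rewrite exprVn mulrC ler_pdivrMr ?exprn_gt0//.
apply: le_trans (ler_sum _ (fun tau _ => le_tau tau)) _.
rewrite big_split/= sumr_const cardF sumI -(mulr_natr (fine (Q A))) natrX mulrDl lerD2l.
rewrite mulrAC ler_pdivlMr// -!natrX -!natrM ler_nat.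
have := expn_le_ffact n N; set x := (N ^ n)%N; set y := (N ^_ n)%N; nia.
Qed.

(** The left side is a supremum over finite sets of words; for each such set the finite sum is a
    limit of sums bounded by [sampling]. *)
Lemma epsilon_le_sampling I : regular R I -> mass R I = 1%E ->
  (epsilon (directing I) A <= limn_einf (fun k => (sampling (4 ^ k)%N I)%:E))%E.
Proof.
move=> rI mI; rewrite (epsilon_determined _ dA).
apply: ge_ereal_sup => _ [W [finW WA] <-].
rewrite fsbig_finite//= sumEFin.
set r := finmap.enum_fset (fset_set W).
have h : (fun k => \sum_(w <- r) \prod_(s <- w) freq R (4 ^ k)%N s I) @ \oo -->
    \sum_(w <- r) wmass (directing I) w.
  apply: cvg_sum_seq => w; rewrite /wmass; under eq_bigr do rewrite (directingE _ mI).
  exact: cvg_prod_seq.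
apply: (limn_einf_ge h) => k; rewrite lee_fin.
apply: sum_prod_freq_le; first exact: finmap.fset_uniq.
by move=> w; rewrite in_fset_set// => /set_mem/WA.
Qed.

Lemma mixture_le : (\int[Q]_I epsilon (directing I) A <= Q A)%E.
Proof.
have mA : measurable A by exact: determined_measurable dA.
have mS k : measurable_fun [set: Network] (fun I => (sampling (4 ^ k)%N I)%:E).
  by apply/measurable_EFinP; exact: measurable_sampling.
apply: (@le_trans _ _ (\int[Q]_I limn_einf (fun k => (sampling (4 ^ k)%N I)%:E))%E).
  apply: ae_ge0_le_integral => //.
  - exact: measurable_epsilon_directing.
  - move=> I _; apply: (limn_einf_ge (u := cst 0)) => [|k]; first exact: cvg_cst.
    by rewrite lee_fin sampling_ge0.
  - exact: measurable_limn_einf.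
  have := ae_mass1 Qexch Qblip; have := ae_regular Qexch.
  by apply: filterS2 => I rI mI _; exact: epsilon_le_sampling.
have := @fatou _ _ _ Q setT measurableT (fun k I => (sampling (4 ^ k)%N I)%:E) mS.
move=> /(_ _)/le_trans; apply.
  by move=> k I _; rewrite lee_fin sampling_ge0.
rewrite -[leRHS]fineK ?fin_num_measure// -[fine _]addr0.
apply: (limn_einf_le (u := fun k => fine (Q A) + (n ^ 2)%:R / (4 ^ k)%:R)).
  by apply: cvgD; [exact: cvg_cst|exact: cvg_pow4V].
by move=> k; apply: integral_sampling; rewrite expn_gt0.
Qed.

End determined_event.

Lemma mixture_determined n (A : set Network) : determined n A ->
  (\int[Q]_I epsilon (directing I) A = Q A)%E.
Proof.
move=> dA; have mA : measurable A by exact: determined_measurable dA.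
have le1 := mixture_le dA; have le2 := mixture_le (determinedC dA).
have m1 := measurable_epsilon_directing.
have add1 : (\int[Q]_I epsilon (directing I) A +
    \int[Q]_I epsilon (directing I) (~` A) = 1)%E.
  rewrite -ge0_integralD//; [|exact: m1|by apply: m1; exact: measurableC].
  rewrite (eq_integral (cst 1%E)).
    rewrite integral_cst// mul1e; exact: probability_setT.
  move=> I _; rewrite probability_setC// addeC subeK//.
  exact: fin_num_measure.
apply/eqP; rewrite eq_le le1/=.
move: le1 le2 add1; rewrite probability_setC//.
rewrite -[Q A]fineK ?fin_num_measure//.
set x := (\int[Q]_I _)%E; set y := (\int[Q]_I _)%E.
have x0 : (0 <= x)%E by exact: integral_ge0.
have y0 : (0 <= y)%E by exact: integral_ge0.
(* Two integrals bounded by [Q A] and [1 - Q A] but summing to 1 must attain their bounds. *)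
move: x y x0 y0 => [x| |] [y| |] //= _ _.
rewrite -EFinB !lee_fin -EFinD => h1 h2 [h3]; lra.
Qed.

(** Both sides are probability measures in [A] and agree on the pi-system of cylinders. *)
Lemma mixture_eq (A : set Network) : measurable A ->
  Q A = (\int[Q]_I epsilon (directing I) A)%E.
Proof.
rewrite measurable_NetworkE; move: A.
apply: (@dynkin_induction _ Network) => //.
- exact: measurable_NetworkE.
- exact: cylinder_setI_closed.
- by rewrite (mixture_determined (@determinedT 0)).
- move=> _ [[n [I ->]]|->].
    by rewrite (mixture_determined (@determined_cylinder n I)).
  by rewrite measure0 integral0_eq.
- move=> S mS hS.
  rewrite probability_setC// hS.
  under [RHS]eq_integral do rewrite probability_setC//.
  rewrite integralB//; last 2 first.
  - exact: (finite_measure_integrable_cst Q 1).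
  - apply: (@le_integrable _ _ _ _ _ _ _ (cst 1%E)) => //.
    + exact: measurable_epsilon_directing.
    + by move=> I _; rewrite gee0_abs// gee0_abs// probability_le1.
    + exact: (finite_measure_integrable_cst Q 1).
  rewrite integral_cst// mul1e; congr (_ - _)%E.
  exact/esym/probability_setT.
- move=> F mF tF hF.
  rewrite measure_semi_bigcup//; last exact: bigcupT_measurable.
  under [RHS]eq_integral => I _.
    rewrite measure_semi_bigcup//; last exact: bigcupT_measurable.
    over.
  rewrite integral_nneseries//; last by move=> k; exact: measurable_epsilon_directing.
  by apply: eq_eseriesr => k _; exact: hF.
Qed.

End mixture.

Unset Implicit Arguments.
Local Open Scope ereal_scope.

Theorem theorem4p2 (R : realType) (d : measure_display)
  (Omega : measurableType d) (P : probability Omega R)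
  (Y : Omega -> Network)
  (Ymeas : measurable_fun [set: Omega] Y)
  (Yexch : forall sigma sinv : nat -> nat, cancel sigma sinv -> cancel sinv sigma ->
     forall A : set Network, measurable A ->
       P ((fun w => (edge_relabel sinv (Y w) : Network)) @^-1` A) = P (Y @^-1` A))
  (Yblip : P (Y @^-1` [set I : Network | blip_free I]) = 1) :
  exists (phi : probability (F1space R) R) (eps : F1 R -> set Network -> \bar R),
    (forall f : F1 R, is_epsilon (F1val f) (eps f)) /\
    (forall A : set Network, measurable A ->
       P (Y @^-1` A) = \int[phi]_(f in [set: F1space R]) eps f A).
Proof.
pose Ym : {mfun Omega >-> Network} :=
  HB.pack Y (isMeasurableFun.Build _ _ _ _ Y Ymeas).
pose Q : probability Network R := distribution P Ym.
have Qexch (sigma sinv : nat -> nat) : cancel sigma sinv -> cancel sinv sigma ->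
    forall A : set Network, measurable A ->
    Q [set I | A (edge_relabel sinv I)] = Q A.
  by move=> sK sinvK A mA; exact: (Yexch sigma sinv sK sinvK A mA).
pose F : {mfun Network >-> F1space R} :=
  HB.pack (@directing R) (isMeasurableFun.Build _ _ _ _ _ (@measurable_directing R)).
(* The mixing measure is the law of the limiting frequencies of [Y]. *)
exists (distribution Q F), (fun f => epsilon f); split=> [f|A mA].
  exact: epsilon_is_epsilon.
rewrite (ge0_integral_distribution F).
- exact: (mixture_eq Qexch Yblip mA).
- exact: measurable_epsilon.
- by move=> f.
Qed.
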